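(* Let $f:\mathbb{R}\to[0,\infty)$ be a density function satisfying: $f(x)=f(-x)$ for all $x$; $f(0)=0$; $f'(x)\ge 0$ for $x>0$; and $[\log f(x)]''<0$ for $x\ne 0$. Then for any $n\in\mathbb{N}$ and any collection of $n$ masses $0<M_1\le M_2\le\dots\le M_n$, the standard configuration is the only isoperimetric $n$-bubble with these masses (uniqueness being understood up to reflection across the origin and up to the choice of ordering among regions of equal mass).
   Context: The weighted mass of an interval $[a,b]$ is $\int_a^b f$. A region is a collection of disjoint intervals $[a_i,b_i]\subset\mathbb{R}$; its mass is $\sum_i\int_{a_i}^{b_i}f$. A configuration of $n$ regions $R_1,\dots,R_n$ is a choice of $n$ regions such that any two intervals belonging to different regions are either disjoint or meet at a single endpoint. Its total perimeter is the sum of $f(x)$ over the endpoints $x$ of the intervals of the regions, where a point at which two intervals meet is counted only once. A configuration with masses $M_1,\dots,M_n$ is isoperimetric (an $n$-bubble) if its total perimeter is least among all configurations of $n$ regions with the same masses. Standard configuration: index the regions so that $R_i$ has mass $M_i$ and $M_1\le\dots\le M_n$. The configuration is standard if each region is a single interval contained in $[0,\infty)$ or in $(-\infty,0]$; all intervals are adjacent (their union is an interval) and the origin is contained in at least one of them, possibly as an endpoint; on each side of the origin the intervals increase in mass (and index) moving outward from the origin; and all odd-indexed regions lie on the side of the origin opposite to all even-indexed regions. *)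

(* Defs.v *)
From HB Require Import structures.
From mathcomp Require Import all_boot all_order all_algebra all_fingroup.
From mathcomp Require Import all_classical all_reals all_analysis.
Import Order.TTheory GRing.Theory Num.Theory.
Import numFieldNormedType.Exports.

Set Implicit Arguments.
Unset Strict Implicit.
Unset Printing Implicit Defensive.

Local Open Scope classical_set_scope.
Local Open Scope ring_scope.

(* The interval [a, b] is represented by the pair (a, b), and a collection of
   intervals by a set of such pairs, of arbitrary cardinality. *)
Definition itv_set (R : realType) (I : R * R) : set R :=
  [set x | I.1 <= x <= I.2].

(* The intervals are nondegenerate: where the density vanishes, a one-point
   interval has neither mass nor perimeter, and allowing it would make every
   uniqueness claim fail. *)
Definition is_region (R : realType) (S : set (R * R)) : Prop :=
  (forall I, S I -> I.1 < I.2) /\ trivIset S (@itv_set R).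

Definition mass (R : realType) (f : R -> R) (S : set (R * R)) : \bar R :=
  (\esum_(I in S) \int[@lebesgue_measure R]_(x in itv_set I) (f x)%:E)%E.

Definition is_endpoint (R : realType) (x : R) (I : R * R) : Prop :=
  x = I.1 \/ x = I.2.

Definition is_configuration (R : realType) (n : nat)
    (C : 'I_n -> set (R * R)) : Prop :=
  (forall i, is_region (C i)) /\
  (forall i j I J, i != j -> C i I -> C j J ->
     itv_set I `&` itv_set J = set0 \/
     exists x, [/\ is_endpoint x I, is_endpoint x J
                 & itv_set I `&` itv_set J = [set x]]).

(* As a set, so that a point at which two intervals meet is counted once. *)
Definition endpoints (R : realType) (n : nat) (C : 'I_n -> set (R * R)) :
    set R :=
  [set x | exists i, exists2 I, C i I & is_endpoint x I].

Definition perimeter (R : realType) (n : nat) (f : R -> R)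
    (C : 'I_n -> set (R * R)) : \bar R :=
  (\esum_(x in endpoints C) (f x)%:E)%E.

Definition has_masses (R : realType) (n : nat) (f : R -> R) (M : 'I_n -> R)
    (C : 'I_n -> set (R * R)) : Prop :=
  forall i, mass f (C i) = (M i)%:E.

Definition is_isoperimetric (R : realType) (n : nat) (f : R -> R)
    (M : 'I_n -> R) (C : 'I_n -> set (R * R)) : Prop :=
  [/\ is_configuration C, has_masses f M C &
      forall D : 'I_n -> set (R * R), is_configuration D -> has_masses f M D ->
        (perimeter f C <= perimeter f D)%E].

Definition right_side (R : realType) : set R := [set x | 0 <= x].
Definition left_side (R : realType) : set R := [set x | x <= 0].

(* Regions are numbered from 0 in 'I_n, so the usual index of i is i.+1. *)
Definition is_standard (R : realType) (n : nat) (f : R -> R) (M : 'I_n -> R)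
    (C : 'I_n -> set (R * R)) : Prop :=
  [/\ is_configuration C, has_masses f M C &
  exists I : 'I_n -> R * R,
    (forall i, C i = [set I i]) /\
    (forall i, itv_set (I i) `<=` @right_side R \/
               itv_set (I i) `<=` @left_side R) /\
    is_interval (\bigcup_(i in [set: 'I_n]) itv_set (I i)) /\
    (exists i, itv_set (I i) 0) /\
    (forall i j, itv_set (I i) `<=` @right_side R ->
                 itv_set (I j) `<=` @right_side R ->
       (I i).2 <= (I j).1 -> (i < j)%N /\ M i <= M j) /\
    (forall i j, itv_set (I i) `<=` @left_side R ->
                 itv_set (I j) `<=` @left_side R ->
       (I j).2 <= (I i).1 -> (i < j)%N /\ M i <= M j) /\
    ((forall i, itv_set (I i) `<=`
        if odd i.+1 then @right_side R else @left_side R) \/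
     (forall i, itv_set (I i) `<=`
        if odd i.+1 then @left_side R else @right_side R))].

Definition reflect_region (R : realType) (S : set (R * R)) : set (R * R) :=
  [set (- I.2, - I.1) | I in S].

(* Main.v *)
(* Measured by its signed mass G, a point x has cost f x, and in this coordinate
   the density is strictly concave on each side of 0, with slope f'/f.  Let r_q and
   l_q be the distances from 0 to the outermost right and left endpoints of
   region q (0 if there is none).  Nonzero outermost endpoints of different
   regions are distinct, so the perimeter is at least the sum of all f(r_q) + f(l_q).

   Put v_0 = v_1 = 0 and v_(k+2) = v_k + m_k; the standard configuration has its
   endpoints at coordinates +-v_k.  Since v_(k+1) + v_k is the sum of the k least
   masses, repeatedly discarding the regions that reach furthest right and
   furthest left shows that G(r_q) + G(l_q), summed over any k regions, is at
   least v_2 + ... + v_(k+1).  Hence the 2n numbers G(r_q), G(l_q), sorted, have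
   prefix sums at least those of (0, ..., 0, v_2, ..., v_(n+1)), and tangent lines
   together with Abel summation give the lower bound on the perimeter.  Equality
   forces equality of the two sorted lists, and peeling off the regions from the
   outside then identifies the configuration. *)

Require Import Defs.
From HB Require Import structures.
From mathcomp Require Import all_boot all_order all_algebra all_fingroup.
From mathcomp Require Import all_classical all_reals all_analysis.
From mathcomp Require Import measurable_realfun lra zify.
Import Order.TTheory GRing.Theory Num.Theory.
Import numFieldNormedType.Exports.
Local Open Scope ring_scope.

Set Implicit Arguments.
Unset Strict Implicit.
Unset Printing Implicit Defensive.

(** * Alternating sums of masses *)

Section AlternatingSums.
Variables (R : realFieldType) (m : nat -> R).

(** These are the v_k of the overview. The recursion goes by two because the regions alternate
    sides: region [k] will occupy, on its own side, the stretch from [altsum k] to [altsum k.+2]. *)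
Fixpoint altsum k : R :=
  if k is k'.+2 then altsum k' + m k' else 0.

Definition altsum_sum k : R := \sum_(j < k) altsum j.+2.

(** The [k] innermost regions fill the stretch between their two outermost endpoints, which have
    these coordinates on opposite sides of the origin. *)
Lemma altsumS_add k : altsum k.+1 + altsum k = \sum_(j < k) m j.
Proof.
elim: k => [|k IH]; first by rewrite big_ord0 /= addr0.
by rewrite big_ord_recr /= -IH addrAC [altsum k + _]addrC.
Qed.

Lemma altsum_sumSS k :
  altsum_sum k.+2 = altsum_sum k + \sum_(j < k.+2) m j.
Proof. by rewrite -altsumS_add /altsum_sum !big_ord_recr /= -addrA [X in _ + X]addrC. Qed.

Hypothesis m_gt0 : forall k, 0 < m k.
Hypothesis m_le : {homo m : i j / (i <= j)%N >-> i <= j}.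

Lemma altsum_ge0 k : 0 <= altsum k.
Proof.
suff: 0 <= altsum k /\ 0 <= altsum k.+1 by case.
elim: k => [|k [IH1 IH2]]; first by split.
by split=> //=; rewrite addr_ge0 // ltW.
Qed.

Lemma altsum_gt0 k : 0 < altsum k.+2.
Proof. by rewrite /= ltr_wpDl // altsum_ge0. Qed.

Lemma altsum_le_same_parity i j :
  (i <= j)%N -> odd i = odd j -> altsum i <= altsum j.
Proof.
elim/ltn_ind: j i => -[|[|j]] IH i.
- by rewrite leqn0 => /eqP ->.
- by case: i => [|[|i]].
rewrite leq_eqVlt => /predU1P[-> //|ij] oij.
have ij' : (i <= j)%N.
  have : i != j.+1 by apply: contraPneq oij => -> /=; case: (odd j).
  lia.
apply: (le_trans (IH j _ i ij' _)) => //; first by rewrite oij /= negbK.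
by rewrite /= lerDl ltW.
Qed.

Lemma altsum_sum_le i j : (i <= j)%N -> altsum_sum i <= altsum_sum j.
Proof.
move=> /subnKC <-; elim: (j - i)%N => [|k IH]; first by rewrite addn0.
by rewrite addnS /altsum_sum big_ord_recr (le_trans IH) // lerDl; exact: altsum_ge0.
Qed.

Lemma altsum_sumS k : altsum_sum k.+1 = altsum_sum k + altsum k.+2.
Proof. by rewrite /altsum_sum big_ord_recr. Qed.

(** The largest index in [W] is at least [#|W| - 1], so its mass dominates the last term on the
    left; the rest is induction. *)
Lemma sum_first_le (n : nat) (W : {set 'I_n}) :
  \sum_(j < #|W|) m j <= \sum_(i in W) m i.
Proof.
have [k] := ubnP #|W|; elim: k W => // k IH W; rewrite ltnS => Wk.
have [->|/set0Pn[x0 Wx0]] := eqVneq W finset.set0; first by rewrite cards0 big_ord0 big_set0.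
case: (arg_maxnP (fun i : 'I_n => val i) Wx0) => i Wi imax.
have {}Wi : i \in W by [].
rewrite (bigD1 i) //= (cardsD1 i W) Wi add1n big_ord_recr [leRHS]addrC.
apply: lerD.
  rewrite (_ : \sum_(j in W | j != i) m j = \sum_(j in W :\ i) m j).
    by apply: IH; move: Wk; rewrite (cardsD1 i) Wi.
  by apply: eq_bigl => j; rewrite !inE andbC.
apply: m_le.
have /subset_leq_card : W :\ i \subset [set j : 'I_n | (j < i)%N].
  apply/fintype.subsetP => j; rewrite !inE => /andP[ji Wj].
  rewrite ltn_neqAle; apply/andP; split; last exact: imax.
  by apply: contra ji => /eqP/val_inj ->.
move/leq_trans; apply.
rewrite cardsE cardE -(size_map val) -[leqRHS](size_iota 0).
apply: uniq_leq_size; first by rewrite map_inj_uniq ?enum_uniq //; exact: val_inj.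
by move=> j /mapP[a]; rewrite mem_enum => aP ->; rewrite mem_iota.
Qed.

(** * Extents packed around the origin *)

Section Packing.
(** In the application [X q true] and [X q false] are G(r_q) and G(l_q), and [pack] expresses that
    the regions of [W] fit between their furthest left and furthest right endpoints. *)
Variables (n : nat) (X : 'I_n -> bool -> R).
Hypothesis X_ge0 : forall q s, 0 <= X q s.
Hypothesis pack : forall (W : {set 'I_n}) i j, i \in W -> j \in W ->
  (forall q, q \in W -> X q true <= X i true) ->
  (forall q, q \in W -> X q false <= X j false) ->
  \sum_(q in W) m q <= X i true + X j false.

Let Z (W : {set 'I_n}) := \sum_(q in W) (X q true + X q false).

Lemma packS s (W : {set 'I_n}) i j : i \in W -> j \in W ->
  (forall q, q \in W -> X q s <= X i s) ->
  (forall q, q \in W -> X q (~~ s) <= X j (~~ s)) ->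
  \sum_(q in W) m q <= X i s + X j (~~ s).
Proof.
by case: s => Wi Wj Mi Mj; [exact: pack|rewrite addrC; exact: pack].
Qed.

Let Z_D1 s (W : {set 'I_n}) i : i \in W ->
  Z W = Z (W :\ i) + (X i s + X i (~~ s)).
Proof.
move=> Wi; rewrite /Z (bigD1 i) //= addrC; congr (_ + _).
  by apply: eq_bigl => j; rewrite !inE andbC.
by case: s => //; rewrite addrC.
Qed.

Lemma exists_outermost s (W : {set 'I_n}) : (0 < #|W|)%N ->
  exists2 i, i \in W & forall q, q \in W -> X q s <= X i s.
Proof.
case/card_gt0P => x0 Wx0.
case: (Order.TotalTheory.arg_maxP (fun i => X i s) Wx0) => i Wi imax.
by exists i.
Qed.

(** Discard the regions reaching furthest right and furthest left: these two extents cover the total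
    mass of [W], and [altsum_sumSS] accounts for two regions at once. If one region is furthest on
    both sides, only one is discarded and monotonicity of [altsum_sum] closes the gap. *)
Lemma altsum_sum_le_extents (W : {set 'I_n}) :
  altsum_sum #|W| <= \sum_(q in W) (X q true + X q false).
Proof.
rewrite -/(Z W); have [k] := ubnP #|W|; elim: k W => // k IH W; rewrite ltnS => Wk.
case: (posnP #|W|) => [W0|W0].
  rewrite W0 /altsum_sum big_ord0 /Z sumr_ge0 // => q _; exact: addr_ge0.
have [i Wi imax] := exists_outermost true W0.
have [j Wj jmax] := exists_outermost false W0.
have tot := le_trans (sum_first_le W) (pack Wi Wj imax jmax).
rewrite (Z_D1 true Wi) /=.
case: (eqVneq i j) => [ij|ij].
  subst j; move: tot Wk; rewrite (cardsD1 i W) Wi add1n => tot Wk.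
  have := IH (W :\ i) Wk; case: #|_| tot => [|c] tot.
    rewrite /altsum_sum big_ord0 big_ord_recl big_ord0 addr0 /=.
    by move: tot; rewrite big_ord_recl big_ord0 addr0; lra.
  rewrite altsum_sumSS; have := altsum_sum_le (leqnSn c); lra.
have Wj' : j \in W :\ i by rewrite !inE eq_sym ij.
rewrite (Z_D1 true Wj') /=.
move: tot Wk; rewrite (cardsD1 i W) Wi (cardsD1 j) Wj' !add1n => tot Wk.
have := IH (W :\ i :\ j) (ltnW Wk); rewrite altsum_sumSS.
have := X_ge0 i false; have := X_ge0 j true; lra.
Qed.

(** In the equality case every inequality of the peeling is tight. The extents other than those of
    [i] still sum to at least [altsum_sum k], which leaves nothing for the other side of [i].
    Packing then forces the furthest opposite extent up to [altsum k.+1], and the bound for the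
    remaining regions keeps it down to that value. *)
Lemma peel_outermost k (W : {set 'I_n}) s i : #|W| = k.+1 ->
  Z W = altsum_sum k.+1 ->
  i \in W -> (forall q, q \in W -> X q s <= X i s) -> X i s = altsum k.+2 ->
  [/\ X i (~~ s) = 0, Z (W :\ i) = altsum_sum k,
      \sum_(q in W) m q = \sum_(j < k.+1) m j &
      (0 < k)%N -> exists2 j, j \in W :\ i &
        X j (~~ s) = altsum k.+1 /\
        forall q, q \in W :\ i -> X q (~~ s) <= X j (~~ s)].
Proof.
move=> Wk ZW Wi imax Xi.
have W0 : (0 < #|W|)%N by rewrite Wk.
have [j Wj jmax] := exists_outermost (~~ s) W0.
have tot1 := sum_first_le W.
have tot2 := packS Wi Wj imax jmax.
have Wi' : #|W :\ i| = k by move: Wk; rewrite (cardsD1 i) Wi add1n => -[].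
have ZWi := Z_D1 s Wi.
have ZL := altsum_sum_le_extents (W :\ i); rewrite -/(Z _) Wi' in ZL.
rewrite Wk in tot1.
have Xi0 := X_ge0 i (~~ s).
have tk := altsumS_add k.+1.
rewrite ZW Xi altsum_sumS in ZWi.
have Xi' : X i (~~ s) = 0 by lra.
have ZWi' : Z (W :\ i) = altsum_sum k by lra.
case: (posnP k) => [k0|k0].
  have ji : j = i.
    apply/eqP; apply/negPn/negP => ji.
    have : j \in W :\ i by rewrite !inE ji.
    by move: Wi'; rewrite k0 => /cards0_eq ->; rewrite inE.
  subst j; split => //.
  have v1 : altsum k.+1 = 0 by rewrite k0.
  lra.
have ji : j != i.
  (* The opposite extent of [i] is 0, whereas packing asks for at least [altsum k.+1], which is
     positive here. *)
  apply/eqP => ji; subst j.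
  case: k k0 Wk ZW Xi Wi' ZWi ZL tot1 tk ZWi' => // k _ Wk ZW Xi Wi' ZWi ZL tot1 tk ZWi'.
  by have := altsum_gt0 k; lra.
have Wj' : j \in W :\ i by rewrite !inE ji.
have ZWj := Z_D1 (~~ s) Wj'; rewrite negbK in ZWj.
have Xj0 := X_ge0 j s.
have ZL2 := altsum_sum_le_extents (W :\ i :\ j); rewrite -/(Z _) in ZL2.
have Wj2 : #|W :\ i :\ j| = k.-1.
  by move: Wi'; rewrite (cardsD1 j) Wj' add1n; lia.
rewrite Wj2 in ZL2.
have Ykk : altsum_sum k = altsum_sum k.-1 + altsum k.+1.
  by rewrite -[in LHS](prednK k0) altsum_sumS (prednK k0).
have Xj : X j (~~ s) = altsum k.+1 by lra.
split => //; first by lra.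
move=> _; exists j => //; split => // q; rewrite inE => /andP[_ Wq]; exact: jmax.
Qed.

(** This iterates [peel_outermost], switching sides at each step. [t] lists the regions from the
    inside outwards, so [t k.-1] is peeled first and lies on side [s]. *)
Lemma extents_alternate k (W : {set 'I_n}) s i : #|W| = k ->
  Z W = altsum_sum k ->
  ((0 < k)%N -> i \in W /\ (forall q, q \in W -> X q s <= X i s) /\ X i s = altsum k.+1) ->
  \sum_(q in W) m q = \sum_(j < k) m j /\
  exists t : nat -> 'I_n, [/\ {in gtn k &, injective t},
    forall a, (a < k)%N -> t a \in W &
    forall a, (a < k)%N ->
     let sa := odd (k.-1 - a) (+) s in
     [/\ m (t a) = m a, X (t a) sa = altsum a.+2 & X (t a) (~~ sa) = 0]].
Proof.
elim: k W s i => [|k IH] W s i Wk ZW.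
  move/cards0_eq: Wk => -> _; rewrite big_set0 big_ord0; split => //.
  by exists (fun=> i); split.
case=> // Wi [imax Xi].
have [Xi' ZWi tot nxt] := peel_outermost Wk ZW Wi imax Xi.
have Wi' : #|W :\ i| = k by move: Wk; rewrite (cardsD1 i) Wi add1n => -[].
have [j Hj] : exists j, (0 < k)%N -> j \in W :\ i /\
   (forall q, q \in W :\ i -> X q (~~ s) <= X j (~~ s)) /\ X j (~~ s) = altsum k.+1.
  case: (posnP k) => [->|k0]; first by exists i.
  by have [j Wj [Xj jmax]] := nxt k0; exists j.
have [tot' [t [t_inj tW tP]]] := IH (W :\ i) (~~ s) j Wi' ZWi Hj.
split => //.
(* The total masses before and after peeling are the sums of the [k.+1] and of the [k] least masses;
   their difference is the mass of [i]. *)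
have mi : m i = m k.
  move: tot; rewrite (bigD1 i) //= big_ord_recr /= -tot' addrC.
  rewrite (_ : \sum_(q in W | q != i) m q = \sum_(q in W :\ i) m q); first exact: addrI.
  by apply: eq_bigl => q; rewrite !inE andbC.
have tW' a : (a < k)%N -> t a != i /\ t a \in W.
  by move=> /tW; rewrite !inE => /andP[].
exists (fun a => if a == k then i else t a); split.
- move=> a b; rewrite !inE => ak bk.
  case: eqVneq => [->|nak]; case: eqVneq => [->|nbk] //.
  + by move=> itb; have [] := tW' b; [lia|rewrite itb eqxx].
  + by move=> ita; have [] := tW' a; [lia|rewrite ita eqxx].
  + by apply: t_inj; rewrite inE; lia.
- by move=> a ak; case: eqVneq => [//|nak]; apply: (tW' a _).2; lia.
move=> a ak; case: eqVneq => [->|nak] /=; first by rewrite subnn.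
have ak' : (a < k)%N by lia.
have := tP a ak'.
rewrite (_ : odd (k.-1 - a) (+) ~~ s = odd (k - a) (+) s) //.
by rewrite (_ : (k - a)%N = (k.-1 - a).+1); [rewrite /= addbN addNb|lia].
Qed.

End Packing.
End AlternatingSums.

(** * Comparison of extents with alternating sums *)

(** Summation by parts: since [c] does not increase, each weighted partial sum stays above [c k]
    times the partial sum of [d]. *)
Lemma abel_sum_ge0 (R : realFieldType) (N : nat) (c d : nat -> R) :
  (forall k, (k < N)%N -> 0 <= c k) ->
  (forall k, (k.+1 < N)%N -> c k.+1 <= c k) ->
  (forall k, (k <= N)%N -> 0 <= \sum_(j < k) d j) ->
  0 <= \sum_(k < N) c k * d k.
Proof.
move=> c0 cdec d0; case: N c0 cdec d0 => [|N] c0 cdec d0; first by rewrite big_ord0.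
suff H k : (k <= N)%N -> c k * (\sum_(j < k.+1) d j) <= \sum_(j < k.+1) c j * d j.
  by apply: le_trans (H N _) => //; rewrite mulr_ge0 ?c0 ?d0.
elim: k => [|k IH] kN; first by rewrite !big_ord_recl !big_ord0 !addr0 lexx.
rewrite big_ord_recr [leRHS]big_ord_recr /= mulrDr lerD2r.
apply: le_trans (IH (ltnW kN)).
by rewrite ler_wpM2r ?d0 ?cdec //; lia.
Qed.

Section Comparison.
Variables (R : realFieldType) (f G h : R -> R).
Hypothesis f0 : f 0 = 0.
Hypothesis G0 : G 0 = 0.
Hypothesis G_mono : {mono G : x y / x <= y}.
Hypothesis h_ge0 : forall x : R, 0 < x -> 0 <= h x.
Hypothesis h_le : forall x y : R, 0 < x -> x <= y -> h y <= h x.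
Hypothesis tangent : forall x y : R, 0 < x -> 0 <= y -> x != y ->
  h x * (G x - G y) < f x - f y.

Variable m : nat -> R.
Hypothesis m_gt0 : forall k, 0 < m k.
Hypothesis m_le : {homo m : i j / (i <= j)%N >-> i <= j}.
Variable e : nat -> R.
Hypothesis Ge : forall k, G (e k) = altsum m k.

Variables (n : nat) (x : 'I_n -> bool -> R).
Hypothesis x_ge0 : forall q s, 0 <= x q s.
Hypothesis pack : forall (W : {set 'I_n}) i j, i \in W -> j \in W ->
  (forall q, q \in W -> x q true <= x i true) ->
  (forall q, q \in W -> x q false <= x j false) ->
  \sum_(q in W) m q <= G (x i true) + G (x j false).
Hypothesis n_gt0 : (0 < n)%N.

Let T : finType := ('I_n * bool)%type.
Let xp (p : T) := x p.1 p.2.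
Let le_x (p q : T) := xp p <= xp q.
Let s := sort le_x (enum T).
Let p0 : T := (Ordinal n_gt0, true).
Let xs k := xp (nth p0 s k).
Let X q b := G (x q b).

Let X_ge0 q b : 0 <= X q b.
Proof. by rewrite -G0 G_mono. Qed.

Let packX (W : {set 'I_n}) i j : i \in W -> j \in W ->
  (forall q, q \in W -> X q true <= X i true) ->
  (forall q, q \in W -> X q false <= X j false) ->
  \sum_(q in W) m q <= X i true + X j false.
Proof.
move=> Wi Wj Mi Mj; apply: pack => // q Wq; rewrite -G_mono; [exact: Mi|exact: Mj].
Qed.

Let size_s : size s = (n + n)%N.
Proof. by rewrite size_sort -cardE card_prod card_ord card_bool muln2 addnn. Qed.

Let s_uniq : uniq s.
Proof. by rewrite sort_uniq enum_uniq. Qed.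

Let mem_s p : p \in s.
Proof. by rewrite mem_sort mem_enum. Qed.

Let xs_le i j : (i <= j)%N -> (j < n + n)%N -> xs i <= xs j.
Proof.
move=> ij jn.
have le_tr : transitive le_x by move=> a b c; exact: le_trans.
have le_re : reflexive le_x by move=> a; exact: lexx.
have le_tot : total le_x by move=> a b; exact: le_total.
apply: (sorted_leq_nth le_tr le_re p0 (sort_sorted le_tot _)) => //;
  rewrite inE -/s size_s //; exact: leq_ltn_trans jn.
Qed.

Let xs_ge0 k : 0 <= xs k. Proof. exact: x_ge0. Qed.

Let sum_xs (F : R -> R) k : (k <= n + n)%N ->
  \sum_(j < k) F (xs j) = \sum_(p in [set p in take k s]) F (xp p).
Proof.
move=> kn.
rewrite (eq_bigl (fun p => p \in take k s)); last by move=> p; rewrite inE.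
rewrite -big_uniq ?take_uniq //= (big_nth p0) size_takel ?size_s //.
by rewrite big_mkord; apply: eq_bigr => j _; rewrite nth_take.
Qed.

Let sum_xs_all (F : R -> R) :
  \sum_(j < n + n) F (xs j) = \sum_q (F (x q true) + F (x q false)).
Proof.
rewrite sum_xs // -{1}size_s take_size.
rewrite (eq_bigl xpredT); last by move=> p; rewrite inE mem_s.
rewrite -(pair_bigA _ (fun i j => F (x i j))) /=; apply: eq_bigr => q _.
by rewrite big_bool.
Qed.

(* Omitting 2n - k of the 2n extents spares both extents of at least k - n regions. *)
Let prefix_ge k : (k <= n + n)%N -> altsum_sum m (k - n) <= \sum_(j < k) G (xs j).
Proof.
move=> kn; rewrite sum_xs //.
set Q := [set p in take k s].
have cQ : #|Q| = k.
  by rewrite cardsE (card_uniqP (take_uniq _ s_uniq)) size_takel ?size_s.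
pose W := [set q : 'I_n | ((q, true) \in Q) && ((q, false) \in Q)].
have cW : (k - n <= #|W|)%N.
  have : ~: W \subset [set p.1 | p in ~: Q].
    apply/fintype.subsetP => q; rewrite finset.in_setC inE negb_and => /orP[] qQ; apply/imsetP.
      by exists (q, true) => //; rewrite finset.in_setC.
    by exists (q, false) => //; rewrite finset.in_setC.
  move/subset_leq_card/leq_trans => /(_ _ (leq_imset_card _ _)).
  have := cardsC W; have := cardsC Q.
  by rewrite cQ card_prod !card_ord card_bool; move: #|~: Q| #|~: W| #|W| => u v w; lia.
apply: (le_trans (altsum_sum_le m_gt0 cW)).
apply: (le_trans (altsum_sum_le_extents m_gt0 m_le X_ge0 packX W)).
rewrite (bigID (fun p : T => p.1 \in W)) /= -[leLHS]addr0; apply: lerD; last first.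
  by apply: sumr_ge0 => p _; exact: X_ge0.
rewrite (eq_bigl (fun p : T => (p.1 \in W) && true)); last first.
  move=> [q b] /=; rewrite andbT andbC; case: (boolP (q \in W)) => //=.
  by rewrite inE => /andP[]; case: b.
rewrite -(pair_big (fun i => i \in W) xpredT (fun i j => G (x i j))) /=.
by apply: ler_sum => q _; rewrite big_bool.
Qed.

(** A prefix of more than [n] extents must sum to at least [altsum m 2 > 0] in the coordinate [G];
    if [xs k] vanished, so would the whole sorted prefix up to it. *)
Let xs_gt0 k : (n <= k)%N -> (k < n + n)%N -> 0 < xs k.
Proof.
move=> nk kn; rewrite lt_neqAle xs_ge0 andbT; apply/eqP => x0.
have := prefix_ge kn; rewrite big1.
  apply/negP; rewrite -ltNge.
  apply: lt_le_trans (altsum_sum_le m_gt0 (_ : 1 <= k.+1 - n)%N); last by rewrite subSn.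
  by rewrite /altsum_sum big_ord_recl big_ord0 addr0; exact: altsum_gt0.
move=> j _; have /eqP -> : xs j == 0; last exact: G0.
by rewrite eq_le xs_ge0 andbT x0 xs_le //; have := ltn_ord j; lia.
Qed.

(** The extents of the standard configuration: each region has extent 0 on the side it avoids and
    some [e k.+2] on the other. *)
Let es k := if (k < n)%N then 0 else e (k - n).+2.
(* The first n extents may vanish, where h has no meaning; they are compared
   with 0, for which any smaller slope serves. *)
Let c k := h (xs (maxn k n)).

Let e_ge0 k : 0 <= e k.
Proof. by rewrite -G_mono G0 Ge altsum_ge0. Qed.

Let tangent_s k : (k < n + n)%N -> xs k != es k ->
  c k * (G (xs k) - G (es k)) < f (xs k) - f (es k).
Proof.
move=> kn; rewrite /es /c; case: ltnP => nk xe; last first.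
  by apply: tangent => //; exact: xs_gt0.
have xk : 0 < xs k by rewrite lt_neqAle eq_sym xe xs_ge0.
have := tangent xk (lexx 0) xe.
apply: le_lt_trans.
rewrite G0 subr0 ler_wpM2r ?X_ge0 // h_le // xs_le //; lia.
Qed.

Let sum_es (F : R -> R) : F 0 = 0 ->
  \sum_(k < n + n) F (es k) = \sum_(k < n) F (e k.+2).
Proof.
move=> F0; rewrite big_split_ord /= big1 ?add0r => [|k _].
  by apply: eq_bigr => k _; rewrite /es ltnNge leq_addr /= addKn.
by rewrite /es ltn_ord.
Qed.

Let sum_weighted_ge0 : 0 <= \sum_(k < n + n) c k * (G (xs k) - G (es k)).
Proof.
apply: (abel_sum_ge0 (c := c) (d := fun k => G (xs k) - G (es k))).
- by move=> k kn; apply: h_ge0; apply: xs_gt0; lia.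
- move=> k kn; apply: h_le; first by apply: xs_gt0; lia.
  by apply: xs_le; lia.
move=> k kn; rewrite big_split /= sumrN subr_ge0.
suff -> : \sum_(j < k) G (es j) = altsum_sum m (k - n) by exact: prefix_ge.
case: (leqP k n) => nk.
  rewrite /altsum_sum (eqP (_ : (k - n == 0)%N)) ?subn_eq0 // big_ord0 big1 // => j _.
  by rewrite /es ifT ?G0 //; exact: leq_trans nk.
rewrite -(big_mkord xpredT (fun j => G (es j))) (big_cat_nat (n := n)) //= ?(ltnW nk) //.
rewrite big_nat big1 ?add0r => [|j jn]; last by rewrite /es ifT ?G0.
rewrite -{1}[n]add0n big_addn big_mkord; apply: eq_bigr => j _.
by rewrite /es ltnNge leq_addl /= addnK Ge.
Qed.

Lemma comparison_le :
  \sum_(k < n) f (e k.+2) <= \sum_q (f (x q true) + f (x q false)).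
Proof.
rewrite -sum_xs_all -(sum_es f0) -subr_ge0 -sumrB.
apply: (le_trans sum_weighted_ge0); apply: ler_sum => k _.
have [->|xe] := eqVneq (xs k) (es k); first by rewrite !subrr mulr0.
exact/ltW/tangent_s.
Qed.

(** [tangent_s] is strict, so the reversed inequality forces the sorted extents to agree entry by
    entry. The last one is then [e n.+1], and the peeling starts from the region and side attaining
    it. *)
Lemma comparison_eq :
  \sum_q (f (x q true) + f (x q false)) <= \sum_(k < n) f (e k.+2) ->
  exists (b : bool) (t : nat -> 'I_n), {in gtn n &, injective t} /\
    forall a, (a < n)%N ->
     let sa := odd a (+) b in
     [/\ m (t a) = m a, x (t a) sa = e a.+2 & x (t a) (~~ sa) = 0].
Proof.
move=> le_sum.
have xe k : (k < n + n)%N -> xs k = es k.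
  move=> kn; apply/eqP/negPn/negP => nxe.
  have : 0 < \sum_(k < n + n) (f (xs k) - f (es k)).
    apply: (le_lt_trans sum_weighted_ge0); rewrite -subr_gt0 -sumrB.
    rewrite (bigD1 (Ordinal kn)) //= ltr_wpDr //; last by rewrite subr_gt0 tangent_s.
    apply: sumr_ge0 => j _; rewrite subr_ge0.
    have [->|nxej] := eqVneq (xs j) (es j); first by rewrite !subrr mulr0.
    exact/ltW/tangent_s.
  by rewrite sumrB sum_xs_all (sum_es f0) subr_gt0 ltNge le_sum.
set p := nth p0 s (n + n).-1.
have xsl : xp p = e n.+1.
  have := xe (n + n).-1; rewrite /xs -/p => -> //; last lia.
  by rewrite /es ifN; [congr e; lia|rewrite -leqNgt; lia].
have Zs : \sum_(q in [set: 'I_n]) (X q true + X q false) = altsum_sum m n.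
  rewrite (eq_bigl xpredT); last by move=> q; rewrite inE.
  rewrite -(sum_xs_all G) (eq_bigr (fun k : 'I_(n + n) => G (es k))) ?sum_es //.
    by apply: eq_bigr => k _; rewrite Ge.
  by move=> k _; rewrite xe.
have [||_ [t [t_inj _ tP]]] := @extents_alternate R m m_gt0 m_le n X X_ge0 packX
    n [set: 'I_n] p.2 p.1 _ Zs.
- by rewrite cardsT card_ord.
- move=> _; rewrite inE; split=> //; split.
    move=> q _; rewrite G_mono -/(xp (q, p.2)) -/(xp p).
    rewrite -(nth_index p0 (mem_s (q, p.2))).
    have : (index (q, p.2) s < n + n)%N by rewrite -size_s index_mem mem_s.
    by move: (index _ _) => k kn; apply: xs_le; move: kn n_gt0; lia.
  by rewrite /X -/(xp p) xsl Ge.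
(* The peeling counts sides from the outermost region; this bit is the resulting side of [t 0]. *)
exists (odd n.-1 (+) p.2), t; split => // a an sa.
have := tP a an.
rewrite /= (_ : odd (n.-1 - a) (+) p.2 = sa); last first.
  by rewrite /sa oddB ?addbA ?[odd a (+) _]addbC //; lia.
case=> -> xa xna.
have G_inj u v : G u = G v -> u = v.
  by move=> uv; apply/eqP; rewrite eq_le -[u <= v]G_mono -[v <= u]G_mono uv lexx.
by split => //; apply: G_inj; rewrite ?Ge ?G0.
Qed.

End Comparison.

Local Open Scope classical_set_scope.
Local Open Scope ring_scope.

(** * The volume coordinate *)

Section EvenPrimitive.
Variables (R : realType) (g : R -> R).
Hypothesis g_cont : continuous g.
Hypothesis g_even : forall x, g (- x) = g x.
Hypothesis g_gt0 : forall x : R, x != 0 -> 0 < g x.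
Hypothesis g_le : forall x y : R, 0 <= x -> x <= y -> g x <= g y.
Local Notation mu := (@lebesgue_measure R).

Let F x := (\int[mu]_(t in `[0%R, x]) g t)%R.

(** The signed mass between the origin and [x], continued to the left as an odd function because [g]
    is even. *)
Definition even_primitive x := if 0 <= x then F x else - F (- x).
Local Notation G := even_primitive.

Let g_int a b : mu.-integrable `[a, b] (EFin \o g).
Proof.
apply: continuous_compact_integrable; first exact: segment_compact.
exact: continuous_subspaceT.
Qed.

Let F0 : F 0 = 0.
Proof. by rewrite /F set_itv1 Rintegral_set1. Qed.

Let F_deriv (x : R) : 0 < x -> is_derive x 1 F (g x).
Proof.
move=> x0; have x1 : x < x + 1 by rewrite ltrDl.
have [dF <-] := continuous_FTC1_closed x1 (g_int 0 (x + 1)) x0 (g_cont (x:=x)).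
by rewrite derive1E; exact/derivableP.
Qed.

Let F_cont b : 0 <= b -> {within `[0, b], continuous F}.
Proof. by move=> b0; apply: parameterized_integral_continuous. Qed.

Let F_lt a b : 0 <= a -> a < b -> F a < F b.
Proof.
move=> a0 ab.
have [||c] := @MVT R F g a b ab.
- move=> x; rewrite in_itv /= => /andP[ax xb]; apply: F_deriv.
  exact: le_lt_trans ax.
- apply: continuous_subspaceW (F_cont (le_trans a0 (ltW ab))).
  by apply: subset_itv; rewrite bnd_simp.
rewrite in_itv /= => /andP[ac cb] E; rewrite -subr_gt0 E mulr_gt0 ?subr_gt0 //.
by apply: g_gt0; rewrite gt_eqF // (le_lt_trans a0).
Qed.

Let F_ge0 a : 0 <= a -> 0 <= F a.
Proof. by rewrite le_eqVlt => /predU1P[<-|/(F_lt (lexx 0))]; rewrite F0 // => /ltW. Qed.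

Lemma even_primitiveE x : 0 <= x -> G x = F x.
Proof. by rewrite /G => ->. Qed.

Lemma even_primitiveN x : G (- x) = - G x.
Proof.
rewrite /G oppr_ge0 opprK.
case: (ltgtP x 0) => [x0|x0|->]; rewrite ?(ltW x0) ?opprK ?oppr0 ?F0 ?oppr0 //.
Qed.

Lemma even_primitive0 : G 0 = 0.
Proof. by rewrite even_primitiveE. Qed.

Lemma even_primitive_lt : {homo G : x y / x < y}.
Proof.
have pos x y : 0 <= x -> x < y -> G x < G y.
  by move=> x0 xy; rewrite !even_primitiveE ?F_lt // (le_trans x0) // ltW.
move=> x y xy; case: (leP 0 x) => x0; first exact: pos.
case: (leP 0 y) => y0.
  rewrite -[x]opprK even_primitiveN even_primitiveE ?oppr_ge0 ?(ltW x0) //.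
  rewrite even_primitiveE //; apply: lt_le_trans (F_ge0 y0).
  by rewrite oppr_lt0 -F0 F_lt // oppr_gt0.
by rewrite -ltrN2 -!even_primitiveN pos ?ltrN2 // oppr_ge0 ltW.
Qed.

Lemma even_primitive_mono : {mono G : x y / x <= y}.
Proof. exact: le_mono even_primitive_lt. Qed.

Lemma integral_even_primitive a b : a <= b ->
  (\int[mu]_(x in `[a, b]) (g x)%:E = (G b - G a)%:E)%E.
Proof.
pose I c d := (\int[mu]_(x in `[c, d]) g x)%R.
have fin c d : (\int[mu]_(x in `[c, d]) (g x)%:E)%E = (I c d)%:E.
  by rewrite fineK //; apply: integrable_fin_num => //; exact: g_int.
have split c d x : c <= d -> d <= x -> I c x = I c d + I d x.
  move=> cd dx; apply/eqP; rewrite addrC -subr_eq /I Rintegral_itvB //.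
  rewrite Rintegral_itv_obnd_cbnd //; apply: integrableS (g_int d x) => //.
  exact: subset_itv_oc_cc.
have pos c d : 0 <= c -> c <= d -> I c d = G d - G c.
  move=> c0 cd; rewrite !even_primitiveE ?(le_trans c0) //.
  have -> : F d = F c + I c d by exact: (split 0 c d).
  by rewrite addrAC subrr add0r.
have neg c d : 0 <= c -> c <= d -> I (- d) (- c) = G d - G c.
  move=> c0 cd; apply/EFin_inj; rewrite -fin integration_by_substitution_oppr //.
    by rewrite -pos // -fin; apply: eq_integral => x _ /=; rewrite g_even.
  exact: continuous_subspaceT.
rewrite fin => ab; congr (_%:E); case: (leP 0 a) => a0; first exact: pos.
have a0' : 0 <= - a by rewrite oppr_ge0 ltW.
case: (leP b 0) => b0.
  rewrite -{1}[a]opprK -{1}[b]opprK neg ?oppr_ge0 ?lerN2 //.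
  by rewrite !even_primitiveN opprK addrC.
rewrite (split a 0 b) ?(ltW a0) ?(ltW b0) // (pos 0 b) ?(ltW b0) //.
have := neg 0 (- a) (lexx 0) a0'; rewrite opprK oppr0 => ->.
by rewrite !even_primitiveN even_primitive0 !subr0 addrC.
Qed.

Lemma even_primitive_surj y : exists x, G x = y.
Proof.
have pos z : 0 <= z -> exists x, G x = z.
  (* Beyond 1 the integrand is at least [g 1], so the mass over [[1, K]] is at least
     [g 1 * (K - 1) = z]. *)
  move=> z0; pose K := z / g 1 + 1.
  have g1 : 0 < g 1 by apply: g_gt0; rewrite oner_neq0.
  have K1 : 1 <= K by rewrite lerDr divr_ge0 // ltW.
  have K0 : 0 <= K by rewrite (le_trans ler01).
  have FK : z <= F K.
    have [||c] := @MVT_segment R F g 1 K K1.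
    - move=> x; rewrite in_itv /= => /andP[x1 _]; apply: F_deriv.
      exact: lt_trans x1.
    - apply: continuous_subspaceW (F_cont K0).
      by apply: subset_itv; rewrite bnd_simp.
    rewrite in_itv /= => /andP[c1 _] E.
    have : z <= F K - F 1.
      have gc : g 1 <= g c by exact: g_le.
      rewrite E /K addrK -[leLHS](@divfK _ (g 1)) ?gt_eqF // mulrC.
      by rewrite ler_wpM2r // divr_ge0 // ltW.
    by have := F_ge0 ler01; lra.
  have [|c] := @IVT R F 0 K z K0 (F_cont K0).
    by rewrite F0 ge_min z0 le_max FK orbT.
  rewrite in_itv /= => /andP[c0 _] <-; exists c; exact: even_primitiveE.
case: (leP 0 y) => y0; first exact: pos.
have [|x Gx] := pos (- y); first by rewrite oppr_ge0 ltW.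
by exists (- x); rewrite even_primitiveN Gx opprK.
Qed.

(* In the coordinate G the density f has slope h = f'/f, so this is the strict
   tangent-line inequality for a strictly concave function. *)
Lemma even_primitive_tangent (df h : R -> R) :
  (forall x : R, 0 < x -> is_derive x 1 g (df x)) ->
  (forall x, 0 < x -> df x = h x * g x) ->
  (forall x y : R, 0 < x -> x < y -> h y < h x) ->
  forall x y : R, 0 < x -> 0 <= y -> x != y -> h x * (G x - G y) < g x - g y.
Proof.
move=> dg dfE h_lt x y x0 y0 xy; rewrite !even_primitiveE ?(ltW x0) //.
have mvt a b : 0 <= a -> a < b -> exists2 c, a < c < b &
    (g b - g a) - h x * (F b - F a) = (h c - h x) * g c * (b - a).
  (* The derivative of [p] at [z] is [(h z - h x) * g z], whose sign depends on the side of [x] on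
     which [z] lies. *)
  move=> a0 ab; pose p := g - (h x *: F).
  have [||c] := @MVT R p (fun z => df z - h x *: g z) a b ab.
  - move=> z; rewrite in_itv /= => /andP[az _].
    have z0 : 0 < z by exact: le_lt_trans az.
    have dz := dg z z0; have Fz := F_deriv z0.
    exact: is_deriveB.
  - rewrite /p => z; apply: continuousD; first exact: continuous_subspaceT.
    apply: continuousN; apply: continuousZl_tmp; move: z.
    apply: continuous_subspaceW (F_cont (le_trans a0 (ltW ab))).
    by apply: subset_itv; rewrite bnd_simp.
  rewrite in_itv /= => acb E; exists c => //.
  move: E; rewrite dfE; last by case/andP: acb => ac _; exact: le_lt_trans ac.
  rewrite /p !fctE /GRing.scale /= => E; lra.
have [xy'|yx] : x < y \/ y < x by move: xy; case: ltgtP => // ? _; [left|right].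
  have [c /andP[xc cy] E] := mvt x y (ltW x0) xy'.
  have c0 : 0 < c by exact: lt_trans xc.
  have : 0 < (h x - h c) * g c * (y - x).
    by rewrite !mulr_gt0 ?subr_gt0 ?h_lt ?g_gt0 // gt_eqF.
  rewrite -opprB mulrN; lra.
have [c /andP[yc cx] E] := mvt y x y0 yx.
have c0 : 0 < c by exact: le_lt_trans yc.
have : 0 < (h c - h x) * g c * (x - y).
  by rewrite !mulr_gt0 ?subr_gt0 ?h_lt ?g_gt0 // gt_eqF.
by rewrite -E subr_gt0.
Qed.

End EvenPrimitive.

Section VolumeCoordinate.
Variables (R : realType) (f : R -> R).
Hypotheses (f_ge0 : forall x : R, 0 <= f x)
  (f_even : forall x : R, f x = f (- x))
  (f_0 : f 0 = 0)
  (f_deriv : forall x : R, 0 < x -> derivable f x 1 /\ 0 <= derive1 f x)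
  (f_pos : forall x : R, x != 0 -> 0 < f x)
  (lnf_deriv2 : forall x : R, x != 0 ->
     [/\ derivable (fun y => ln (f y)) x 1,
         derivable (derive1 (fun y => ln (f y))) x 1
       & derive1n 2 (fun y => ln (f y)) x < 0]).
Local Notation mu := (@lebesgue_measure R).

Let f_is_derive (x : R) : 0 < x -> is_derive x 1 f (derive1 f x).
Proof. by move=> /f_deriv[df _]; rewrite derive1E; exact/derivableP. Qed.

Lemma density_le (x y : R) : 0 < x -> x <= y -> f x <= f y.
Proof.
move=> x0 xy.
have [||c] := @MVT_segment R f (derive1 f) x y xy.
- move=> z; rewrite in_itv /= => /andP[xz _]; apply: f_is_derive.
  exact: lt_trans xz.
- apply: derivable_within_continuous => z; rewrite in_itv /= => /andP[xz _].
  by apply: (f_deriv _).1; exact: lt_le_trans xz.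
rewrite in_itv /= => /andP[xc _] E; rewrite -subr_ge0 E mulr_ge0 ?subr_ge0 //.
by apply: (f_deriv _).2; exact: lt_le_trans xc.
Qed.

(* f may jump at 0; g is its continuous modification. *)
Let f0plus := inf (f @` [set x | 0 < x]).
Let g (x : R) := if x == 0 then f0plus else f x.

Let has_inf_f : has_inf (f @` [set x | 0 < x]).
Proof.
split; first by exists (f 1), 1 => //=; exact: ltr01.
by exists 0 => _ [x _ <-].
Qed.

Let f0plus_ge0 : 0 <= f0plus.
Proof.
by apply: lb_le_inf; [exact: has_inf_f.1|move=> _ [x _ <-]].
Qed.

Let f0plus_le (x : R) : 0 < x -> f0plus <= f x.
Proof. by move=> x0; apply: (ge_inf has_inf_f.2); exists x. Qed.

Let gE (x : R) : x != 0 -> g x = f x.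
Proof. by rewrite /g => /negbTE ->. Qed.

Let g_even x : g (- x) = g x.
Proof. by rewrite /g oppr_eq0 -f_even. Qed.

Let near_gE (x : R) : x != 0 -> \near x, f x = g x.
Proof.
move=> x0; have : nbhs x [set y | y != 0].
  by apply: open_nbhs_nbhs; split => //; exact: open_neq.
by apply: filterS => y y0; rewrite gE.
Qed.

Let g_is_derive (x : R) : 0 < x -> is_derive x 1 g (derive1 f x).
Proof.
move=> x0; apply: near_eq_is_derive (f_is_derive x0).
by apply: near_gE; rewrite gt_eqF.
Qed.

Let g_gt0 (x : R) : x != 0 -> 0 < g x.
Proof. by move=> x0; rewrite gE // f_pos. Qed.

Let g_le (x y : R) : 0 <= x -> x <= y -> g x <= g y.
Proof.
rewrite le_eqVlt => /predU1P[<-|x0] xy.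
  rewrite {1}/g eqxx; move: xy; rewrite le_eqVlt => /predU1P[<-|y0].
    by rewrite /g eqxx.
  by rewrite gE ?gt_eqF // f0plus_le.
by rewrite !gE ?gt_eqF ?density_le // (lt_le_trans x0).
Qed.

(** At 0, monotonicity makes the infimum over positive arguments the right limit, and evenness
    transfers it to the left. For positive arguments [g] is differentiable, and evenness covers the
    negative ones. *)
Let g_cont : continuous g.
Proof.
have pos (x : R) : 0 < x -> {for x, continuous g}.
  move=> x0; apply/differentiable_continuous/derivable1_diffP.
  exact: (@ex_derive _ _ _ _ _ _ _ (g_is_derive x0)).
move=> x; case: (ltgtP x 0) => [x0|x0|->]; last 2 first.
- exact: pos.
- apply/cvgrPdist_lt => /= e e0.
  have [_ [d /= d0 <-] fd] := inf_adherent e0 has_inf_f.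
  exists d => //= y; rewrite /= sub0r normrN => yd.
  have -> : g y = g `|y|.
    by case: (ger0P y) => // _; rewrite g_even.
  rewrite distrC ger0_norm ?subr_ge0 ?g_le // ltrBlDl {2}/g eqxx.
  by apply: le_lt_trans fd; rewrite -(gE (lt0r_neq0 d0)) g_le // ltW.
have -> : g = g \o -%R by apply/funext => z /=; rewrite g_even.
apply: continuous_comp; first exact: oppr_continuous.
by apply: pos; rewrite oppr_gt0.
Qed.

Let h : R -> R := derive1 (fun y => ln (f y)).

Let hE (x : R) : 0 < x -> derive1 f x = h x * g x.
Proof.
move=> x0; have x1 : x != 0 by rewrite gt_eqF.
have fx0 := f_pos x1; have lnd := is_derive1_ln fx0.
have := @derive1_comp R f (@ln R) x (f_deriv x0).1 (ex_derive (is_derive := lnd)).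
rewrite -/h => ->; rewrite (derive1E (@ln R)) (@derive_val _ _ _ _ _ _ _ lnd).
by rewrite gE // mulrAC mulVf ?mul1r // gt_eqF.
Qed.

Let h_lt (x y : R) : 0 < x -> x < y -> h y < h x.
Proof.
move=> x0 xy.
have [||c] := @MVT R h (derive1 h) x y xy.
- move=> z; rewrite in_itv /= => /andP[xz _].
  have [//|_ dh _] := @lnf_deriv2 z; first by rewrite gt_eqF // (lt_trans x0).
  by rewrite derive1E; exact/derivableP.
- apply: derivable_within_continuous => z; rewrite in_itv /= => /andP[xz _].
  by have [//|_ dh _] := @lnf_deriv2 z; first by rewrite gt_eqF // (lt_le_trans x0).
rewrite in_itv /= => /andP[xc _] E; rewrite -subr_lt0 E nmulr_rlt0 ?subr_gt0 //.
by have [//|_ _] := @lnf_deriv2 c; first by rewrite gt_eqF // (lt_trans x0).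
Qed.

Let h_ge0 (x : R) : 0 < x -> 0 <= h x.
Proof.
move=> x0; have := (f_deriv x0).2; rewrite hE // pmulr_lge0 //.
by rewrite g_gt0 // gt_eqF.
Qed.

(** [G] is built from the continuous [g]. It measures [f] as well because the two functions can
    differ only at 0, a null set; and the tangent inequality passes from [g] to [f] because
    [f 0 = 0] is at most [g 0]. *)
Lemma volume_coordinate : exists G h : R -> R,
  [/\ {mono G : x y / x <= y},
      forall x, G (- x) = - G x,
      forall y, exists x, G x = y &
      forall a b, a <= b ->
        (\int[mu]_(x in `[a, b]) (f x)%:E = (G b - G a)%:E)%E] /\
  [/\ forall x : R, 0 < x -> 0 <= h x,
      forall x y : R, 0 < x -> x <= y -> h y <= h x &
      forall x y : R, 0 < x -> 0 <= y -> x != y ->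
        h x * (G x - G y) < f x - f y].
Proof.
exists (even_primitive g), h; split; split.
- exact: even_primitive_mono.
- exact: even_primitiveN.
- exact: even_primitive_surj.
- move=> a b ab; rewrite -integral_even_primitive //.
  have mD : measurable (`[a, b] `\ 0 : set R) by exact: measurableD.
  pose eg : R -> \bar R := EFin \o g.
  have mg : measurable_fun (`[a, b] `\ 0) eg.
    by apply/measurable_EFinP; apply: measurable_funTS; exact: continuous_measurable_fun.
  have gfE x : x \in `[a, b] `\ 0 -> (g x)%:E = (f x)%:E.
    by rewrite inE /= => -[_ /eqP x0]; rewrite gE.
  rewrite -[RHS](@integral_setD1 _ _ 0) // -[LHS](@integral_setD1 _ _ 0) //.
    by apply: eq_integral => x /gfE ->.
  exact: eq_measurable_fun gfE mg.
- exact: h_ge0.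
- by move=> x y x0; rewrite le_eqVlt => /predU1P[->//|/(h_lt x0)/ltW].
move=> x y x0 y0 xy.
have := even_primitive_tangent g_cont g_gt0 g_is_derive hE h_lt x0 y0 xy.
move/lt_le_trans; apply; rewrite gE ?gt_eqF // lerD2l lerN2.
rewrite /g; case: eqP => [->|//]; by rewrite f_0 f0plus_ge0.
Qed.

End VolumeCoordinate.

(** * Configurations of intervals *)

Section Esum.
Variables (R : realType) (T : choiceType) (a : T -> R).
Hypothesis a_ge0 : forall x, 0 <= a x.

Lemma esum_ge_seq (E : set T) (s : seq T) : uniq s -> [set` s] `<=` E ->
  ((\sum_(x <- s) a x)%:E <= \esum_(x in E) (a x)%:E)%E.
Proof.
move=> us sE; apply: esum_ge; exists [set` s]; first by split.
by rewrite -fsbig_seq // sumEFin.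
Qed.

Lemma esum_le_seq (E : set T) (B : R) :
  (forall s, uniq s -> [set` s] `<=` E -> \sum_(x <- s) a x <= B) ->
  (\esum_(x in E) (a x)%:E <= B%:E)%E.
Proof.
move=> sB; apply: ge_ereal_sup => _ [X [finX XE] <-].
rewrite fsbig_finite //= sumEFin lee_fin sB //.
by rewrite fset_setK.
Qed.

Lemma sum_uniq_le (s t : seq T) : uniq s -> {subset s <= t} ->
  \sum_(x <- s) a x <= \sum_(x <- t) a x.
Proof.
elim: s t => [|x s IH] t /=; first by rewrite big_nil sumr_ge0.
case/andP => xs us st; have xt : x \in t by apply: st; rewrite inE eqxx.
rewrite (perm_big _ (perm_to_rem xt)) !big_cons lerD2l; apply: IH => // y ys.
have : y \in x :: rem x t by rewrite -(perm_mem (perm_to_rem xt)) st // inE ys orbT.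
by rewrite inE => /predU1P[yx|//]; move: xs; rewrite -yx ys.
Qed.

(** More than S / c terms of size at least [c] would exceed the sum S. Applied to a finite
    perimeter, this leaves finitely many endpoints away from the origin. *)
Lemma esum_finite_above (E : set T) (c : R) : 0 < c ->
  (\esum_(x in E) (a x)%:E < +oo)%E -> finite_set (E `&` [set x | c <= a x]).
Proof.
move=> c0 lty; apply: contrapT => inf.
have fin : \esum_(x in E) (a x)%:E \is a fin_num.
  by rewrite ge0_fin_numE // esum_ge0 // => x _; rewrite lee_fin.
set S := \esum_(x in E) _ in fin.
have [X XE cX] := infinite_set_fset (Num.bound (fine S / c)) inf.
have : ((\sum_(x <- finmap.enum_fset X) a x)%:E <= S)%E.
  by apply: esum_ge_seq => // x /XE[].
rewrite -(fineK fin) lee_fin; apply/negP; rewrite -ltNge.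
apply: (@lt_le_trans _ _ (c *+ size (finmap.enum_fset X))).
  rewrite -mulr_natr mulrC -ltr_pdivrMr //.
  apply: lt_le_trans (archi_boundP _) _; last by rewrite ler_nat.
  by rewrite divr_ge0 ?fine_ge0 ?esum_ge0 // => [x _|]; rewrite ?lee_fin // ltW.
have -> : c *+ size (finmap.enum_fset X) = \sum_(x <- finmap.enum_fset X) c.
  by rewrite big_const_seq count_predT iter_addr_0.
by rewrite big_seq [leRHS]big_seq; apply: ler_sum => x /XE[].
Qed.
End Esum.

Lemma seq_argmax (R : realDomainType) (T : eqType) (F : T -> R) (s : seq T) x0 :
  x0 \in s -> exists2 x, x \in s & forall y, y \in s -> F y <= F x.
Proof.
elim: s x0 => // y [|z s] IH x0 _.
  by exists y => [|w]; rewrite inE // => /eqP ->.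
have [x xs xmax] := IH z (mem_head _ _); case: (leP (F y) (F x)) => yx.
  by exists x => [|w]; rewrite inE ?xs ?orbT // => /predU1P[->|/xmax].
exists y => [|w]; rewrite inE ?eqxx // => /predU1P[->//|/xmax].
by move/le_trans; apply; exact: ltW.
Qed.

(** * Relative position of intervals *)

Section Intervals.
Variable R : realType.
Implicit Types (I J : R * R) (G : R -> R).

(** Overlapping intervals would share the larger left end and the smaller right end, two distinct
    points, whereas at most one common point is allowed. *)
Lemma itv_separated I J : I.1 < I.2 -> J.1 < J.2 ->
  (itv_set I `&` itv_set J = set0 \/
   exists x, [/\ is_endpoint x I, is_endpoint x J & itv_set I `&` itv_set J = [set x]]) ->
  I.2 <= J.1 \/ J.2 <= I.1.
Proof.
move=> I12 J12 H; case: (leP I.2 J.1) => IJ; first by left.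
case: (leP J.2 I.1) => JI; first by right.
exfalso; pose p := Num.max I.1 J.1; pose q := Num.min I.2 J.2.
have pq : p < q by rewrite /p /q lt_min !gt_max I12 J12 IJ JI.
have pI : (itv_set I `&` itv_set J) p.
  rewrite /itv_set /= !le_max !lexx orbT /=.
  by rewrite ![p <= _]ge_max !(ltW I12) ?(ltW J12) ?(ltW IJ) ?(ltW JI).
have qI : (itv_set I `&` itv_set J) q.
  rewrite /itv_set /= !ge_min !lexx orbT /=.
  by rewrite ![_ <= q]le_min !(ltW I12) ?(ltW J12) ?(ltW IJ) ?(ltW JI).
case: H => [H|[x [_ _ H]]]; first by rewrite H in pI.
by move: pq; rewrite H in pI qI; rewrite pI qI ltxx.
Qed.

Lemma itv_touching I J : I.1 < I.2 -> J.1 < J.2 ->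
  I.2 <= J.1 \/ J.2 <= I.1 ->
  itv_set I `&` itv_set J = set0 \/
   exists x, [/\ is_endpoint x I, is_endpoint x J & itv_set I `&` itv_set J = [set x]].
Proof.
wlog : I J / I.2 <= J.1.
  move=> H I12 J12 [IJ|JI]; first by apply: H => //; left.
  case: (H J I JI J12 I12 (or_introl JI)) => [E|[x [xJ xI E]]].
    by left; rewrite setIC.
  by right; exists x; rewrite setIC.
move=> IJ I12 J12 _; move: IJ; rewrite le_eqVlt => /predU1P[IJ|IJ].
  right; exists I.2; split; [by right|by left|].
  apply/seteqP; split => x; rewrite /itv_set /=.
    by move=> [/andP[_ xI] /andP[Jx _]]; apply/eqP; rewrite eq_le xI IJ.
  by move=> ->; rewrite (ltW I12) lexx IJ lexx (ltW J12).
left; apply/seteqP; split => x //; rewrite /itv_set /= => -[/andP[_ xI] /andP[Jx _]].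
by have := lt_le_trans (le_lt_trans xI IJ) Jx; rewrite ltxx.
Qed.

(* The intervals are peeled off from the right. *)
Lemma telescoping_le (T : eqType) (F : T -> R * R) G (s : seq T) L U :
  {homo G : x y / x <= y} -> L <= U -> uniq s ->
  (forall p, p \in s -> [/\ L <= (F p).1, (F p).1 < (F p).2 & (F p).2 <= U]) ->
  (forall p q, p \in s -> q \in s -> p != q ->
     (F p).2 <= (F q).1 \/ (F q).2 <= (F p).1) ->
  \sum_(p <- s) (G (F p).2 - G (F p).1) <= G U - G L.
Proof.
move=> G_le; move: U; have [k] := ubnP (size s); elim: k s => // k IH s.
rewrite ltnS => sk U LU us bnd sep.
case: s sk us bnd sep => [|p0 s] sk us bnd sep; first by rewrite big_nil subr_ge0 G_le.
have [p ps pmax] := seq_argmax (fun p => (F p).2) (mem_head p0 s).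
have [Lp p12 pU] := bnd p ps.
rewrite (perm_big _ (perm_to_rem ps)) big_cons /=.
have : \sum_(q <- rem p (p0 :: s)) (G (F q).2 - G (F q).1) <= G (F p).1 - G L.
  apply: IH.
  - by rewrite size_rem.
  - exact: Lp.
  - exact: rem_uniq.
  - move=> q; rewrite (mem_rem_uniq _ us) inE => /andP[qp qs].
    have [Lq q12 qU] := bnd q qs; split => //.
    have pq : p != q by rewrite eq_sym.
    case: (sep p q ps qs pq) => //.
    by move=> pq1; have := pmax q qs; lra.
  by move=> q r /mem_rem qs /mem_rem rs; exact: sep.
have := G_le _ _ pU; lra.
Qed.

(** Beyond a positive element there are finitely many others, so a largest one exists; if no element
    is positive, 0 serves. *)
Lemma exists_outer_endpoint (E : set R) :
  (forall e : R, 0 < e -> finite_set (E `&` [set x | e <= x])) ->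
  exists r, [/\ 0 <= r, forall x, E x -> x <= r & r = 0 \/ E r].
Proof.
move=> finE; case: (pselect (exists2 e, E e & 0 < e)) => [[e Ee e0]|no]; last first.
  exists 0; split => //; last by left.
  by move=> x Ex; rewrite leNgt; apply/negP => x0; apply: no; exists x.
have /finite_seqP[s sE] := finE e e0.
have es : e \in s.
  have : (E `&` [set x | e <= x]) e by split => /=.
  by rewrite sE.
have [r rs rmax] := seq_argmax id es.
have [Er er] : (E `&` [set x | e <= x]) r by rewrite sE.
exists r; split; last by right.
  exact: le_trans (ltW e0) er.
move=> x Ex; case: (leP e x) => ex; last exact: le_trans (ltW ex) er.
by apply: rmax; have : (E `&` [set x | e <= x]) x by []; rewrite sE.
Qed.
End Intervals.

(** * Configurations measured in the volume coordinate *)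

Section Bubbles.
Variables (R : realType) (f G h : R -> R).
Hypothesis f_ge0 : forall x : R, 0 <= f x.
Hypothesis f_even : forall x : R, f x = f (- x).
Hypothesis f_0 : f 0 = 0.
Hypothesis f_pos : forall x : R, x != 0 -> 0 < f x.
Hypothesis f_le : forall x y : R, 0 < x -> x <= y -> f x <= f y.
Hypothesis G_mono : {mono G : x y / x <= y}.
Hypothesis G_odd : forall x, G (- x) = - G x.
Hypothesis G_int : forall a b : R, a <= b ->
  (\int[@lebesgue_measure R]_(x in `[a, b]) (f x)%:E = (G b - G a)%:E)%E.
Hypothesis h_ge0 : forall x : R, 0 < x -> 0 <= h x.
Hypothesis h_le : forall x y : R, 0 < x -> x <= y -> h y <= h x.
Hypothesis tangent : forall x y : R, 0 < x -> 0 <= y -> x != y ->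
  h x * (G x - G y) < f x - f y.

Let G0 : G 0 = 0.
Proof. by have := G_odd 0; rewrite oppr0; lra. Qed.

Let G_lt : {mono G : x y / x < y}. Proof. exact: leW_mono. Qed.

Let G_inj : injective G.
Proof. by move=> x y xy; apply/eqP; rewrite eq_le -(G_mono x) -(G_mono y) xy lexx. Qed.

Let itv_mass (I : R * R) := G I.2 - G I.1.

(** The maximum with 0 leaves the masses of the intervals of a region unchanged and makes the
    summand nonnegative on all pairs, as the lemmas on unordered sums require. *)
Lemma massE (S : set (R * R)) : is_region S ->
  mass f S = (\esum_(I in S) (Num.max 0 (itv_mass I))%:E)%E.
Proof.
move=> [S12 _]; apply: eq_esum => I /S12 I12.
rewrite (_ : itv_set I = [set` `[I.1, I.2]]); last by rewrite set_itvE.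
by rewrite G_int ?(ltW I12) // max_r // subr_ge0 G_mono ltW.
Qed.

Lemma mass_set1 (I : R * R) : I.1 < I.2 -> mass f [set I] = (itv_mass I)%:E.
Proof.
move=> I12; rewrite massE; last first.
  split=> [J ->//|J K -> ->//].
by rewrite esum_set1 ?lee_fin ?le_max ?lexx // max_r // subr_ge0 G_mono ltW.
Qed.

Lemma region_mass_ge (S : set (R * R)) (mS : R) (s : seq (R * R)) :
  is_region S -> mass f S = mS%:E -> uniq s -> [set` s] `<=` S ->
  \sum_(I <- s) itv_mass I <= mS.
Proof.
move=> rS MS us sS; rewrite -lee_fin -MS massE //.
apply: le_trans (esum_ge_seq _ us sS).
by rewrite lee_fin; apply: ler_sum => I _; rewrite le_max lexx orbT.
Qed.

(** A second interval would add positive mass to one that already exhausts [mS]. *)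
Lemma region_eq_set1 (S : set (R * R)) (mS a b : R) :
  is_region S -> mass f S = mS%:E -> S (a, b) -> mS <= G b - G a ->
  S = [set (a, b)] /\ G b - G a = mS.
Proof.
move=> rS MS Sab abm.
have le1 := @region_mass_ge S mS [:: (a, b)] rS MS isT _.
have {}le1 : G b - G a <= mS.
  by have := le1 _; rewrite big_seq1; apply => I /=; rewrite inE => /eqP ->.
split; last by apply/eqP; rewrite eq_le le1.
apply/seteqP; split => [I SI|_ -> //]; apply/eqP/negPn/negP => nI.
have := @region_mass_ge S mS [:: I; (a, b)] rS MS _ _.
rewrite big_cons big_seq1 /= inE nI => /(_ isT) H.
have : itv_mass I + (G b - G a) <= mS.
  by apply: H => J /=; rewrite !inE => /orP[] /eqP ->.
have : 0 < itv_mass I by rewrite subr_gt0 G_lt rS.1.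
lra.
Qed.

(** * Outermost endpoints of an arbitrary configuration *)

Section Configuration.
Variables (n : nat) (C : 'I_n -> set (R * R)).
Hypothesis cC : is_configuration C.

Let C12 i I : C i I -> I.1 < I.2. Proof. exact: (cC.1 i).1. Qed.

Lemma configuration_separated i j I J : C i I -> C j J -> (i, I) <> (j, J) ->
  I.2 <= J.1 \/ J.2 <= I.1.
Proof.
move=> CI CJ IJ; apply: itv_separated; [exact: C12 CI|exact: C12 CJ|].
case: (eqVneq i j) => [ij|ij]; last exact: cC.2 ij CI CJ.
subst j; left; apply/seteqP; split => x // xIJ.
by case: IJ; congr (_, _); apply: (cC.1 i).2 => //; exists x.
Qed.

Variable m : 'I_n -> R.
Hypothesis mC : has_masses f m C.

(** Distinct intervals of the regions are separated, so every finite family of them telescopes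
    inside [[L, U]]; the total mass is the supremum over such families. *)
Lemma packing (W : {set 'I_n}) (L U : R) : L <= U ->
  (forall q I, q \in W -> C q I -> L <= I.1 /\ I.2 <= U) ->
  \sum_(q in W) m q <= G U - G L.
Proof.
move=> LU bnd.
pose a (p : 'I_n * (R * R)) : R := Num.max 0 (itv_mass p.2).
have a_ge0 p : 0 <= a p by rewrite le_max lexx.
rewrite -lee_fin.
apply: (@le_trans _ _ (\esum_(p in [set q | q \in W] `*`` C) (a p)%:E)%E); last first.
  apply: esum_le_seq => s us sW.
  have sW' p : p \in s -> p.1 \in W /\ C p.1 p.2 by move=> /sW [].
  rewrite big_seq (eq_bigr (fun p => itv_mass p.2)) => [|p /sW'[_ /C12 p12]]; last first.
    by rewrite /a max_r // subr_ge0 G_mono ltW.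
  rewrite -big_seq.
  apply: (@telescoping_le R _ (fun p : 'I_n * (R * R) => p.2) G s L U) => //.
  - by move=> x y; rewrite G_mono.
  - move=> p /sW'[pW pC]; have [? ?] := bnd _ _ pW pC.
    by split => //; exact: C12 pC.
  - move=> p q /sW'[pW pC] /sW'[qW qC] pq.
    apply: configuration_separated pC qC _; rewrite -!surjective_pairing.
    exact/eqP.
rewrite -(esum_esum (a := fun q I => (a (q, I))%:E)); last by move=> *; rewrite lee_fin.
have -> : (\sum_(q in W) m q)%:E = (\sum_(q in W) mass f (C q))%E.
  by rewrite -sumEFin; apply: eq_bigr => q _; rewrite mC.
rewrite -big_enum /= fsbig_seq ?enum_uniq // -esum_fset //; last first.
- by move=> q _; rewrite massE ?esum_ge0 //; [move=> I _; rewrite lee_fin le_max lexx|exact: cC.1].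
- rewrite (_ : [set` enum W] = [set q | q \in W]); last first.
    by apply/seteqP; split => q /=; rewrite mem_enum.
  by apply: le_esum => q _; rewrite massE //; exact: cC.1.
Qed.

Hypothesis fin : (perimeter f C < +oo)%E.

(** Since [f] is nondecreasing on the right, an endpoint beyond [e] costs at least [f e], and a
    finite perimeter leaves finitely many of these; evenness gives the same on the left. *)
Lemma outer_endpoints q : exists r l : R,
  [/\ 0 <= r, 0 <= l, forall I, C q I -> - l <= I.1 /\ I.2 <= r,
      r = 0 \/ (exists2 I, C q I & I.2 = r) &
      l = 0 \/ (exists2 I, C q I & I.1 = - l)].
Proof.
have finE c : 0 < c -> finite_set (endpoints C `&` [set x | c <= f x]).
  by move=> c0; exact: esum_finite_above.
have [e e0|r [r0 rmax rE]] := @exists_outer_endpoint R [set I.2 | I in C q].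
  apply: sub_finite_set (finE (f e) _); last by rewrite f_pos // gt_eqF.
  move=> _ [[I CI <-] /= eI]; split; last exact: f_le.
  by exists q; exists I => //; right.
have [e e0|l [l0 lmax lE]] := @exists_outer_endpoint R [set - I.1 | I in C q].
  apply: sub_finite_set (finite_image -%R (finE (f e) _)); last by rewrite f_pos // gt_eqF.
  move=> _ [[I CI <-] /= eI]; exists I.1 => //; split.
    by exists q; exists I => //; left.
  by rewrite /= (f_even I.1) f_le.
exists r, l; split => //.
- move=> I CI; split; last by apply: rmax; exists I.
  by rewrite lerNl; apply: lmax; exists I.
- by case: lE => [->|[I CI E]]; [left|right; exists I => //; rewrite -E opprK].
Qed.

(** Two regions with the same nonzero outermost endpoint on one side would have overlapping
    intervals, so nonzero extents contribute distinct points to the perimeter. The list [t] charges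
    further endpoints on top of them, which the equality case uses to exclude such endpoints. *)
Lemma exists_extents : exists x : 'I_n -> bool -> R,
  [/\ forall q b, 0 <= x q b,
      forall q I, C q I -> - x q false <= I.1 /\ I.2 <= x q true,
      forall q, x q true = 0 \/ (exists2 I, C q I & I.2 = x q true),
      forall q, x q false = 0 \/ (exists2 I, C q I & I.1 = - x q false) &
      forall t : seq R, uniq t -> [set` t] `<=` endpoints C ->
        (forall y, y \in t -> y != 0 /\
           forall q, y <> x q true /\ y <> - x q false) ->
      ((\sum_q (f (x q true) + f (x q false)) + \sum_(y <- t) f y)%:E
        <= perimeter f C)%E].
Proof.
have [r rP] := choice outer_endpoints; have [l lP] := choice rP.
pose x q (b : bool) := if b then r q else l q.
exists x; split.
- by move=> q [] /=; have [] := lP q.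
- by move=> q I; have [_ _ + _ _] := lP q; apply.
- by move=> q; have [] := lP q.
- by move=> q; have [] := lP q.
move=> t ut tC t_new.
pose z (p : 'I_n * bool) := if p.2 then x p.1 true else - x p.1 false.
have z0 p : (z p == 0) = (x p.1 p.2 == 0) by case: p => q []; rewrite /z //= oppr_eq0.
have fz p : f (z p) = f (x p.1 p.2) by case: p => q []; rewrite /z //= -f_even.
have zC p : z p != 0 -> endpoints C (z p).
  rewrite z0; case: p => q [] /=; have [_ _ _ rq lq] := lP q.
    move=> rq0; case: rq => [rq|[I CI Ir]]; first by rewrite rq eqxx in rq0.
    by exists q, I => //; right.
  move=> lq0; case: lq => [lq|[I CI Il]]; first by rewrite lq eqxx in lq0.
  by exists q, I => //; left.
have z_inj p p' : z p != 0 -> z p = z p' -> p = p'.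
  case: p => q b; case: p' => q' b' zp zz.
  have zp' : z (q', b') != 0 by rewrite -zz.
  have [r0 l0 _ rq lq] := lP q; have [r0' l0' _ rq' lq'] := lP q'.
  move: zp zp' zz; rewrite /z /x /=; case: b; case: b' => zp zp' zz.
  - case: rq => [E|[I CI Ir]]; first by rewrite E eqxx in zp.
    case: rq' => [E|[J CJ Jr]]; first by rewrite E eqxx in zp'.
    apply: contrapT => qq.
    have qIJ : (q, I) <> (q', J) by move=> [qq' _]; apply: qq; rewrite qq'.
    case: (configuration_separated CI CJ qIJ) => H.
    + have := C12 CJ; rewrite Jr -zz -Ir; move/lt_le_trans => /(_ _ H); by rewrite ltxx.
    + have := C12 CI; rewrite Ir zz -Jr; move/lt_le_trans => /(_ _ H); by rewrite ltxx.
  - by move: zp; rewrite eq_le r0 andbT zz oppr_le0 l0'.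
  - by move: zp'; rewrite eq_le r0' andbT -zz oppr_le0 l0.
  - case: lq => [E|[I CI Il]]; first by rewrite E oppr0 eqxx in zp.
    case: lq' => [E|[J CJ Jl]]; first by rewrite E oppr0 eqxx in zp'.
    apply: contrapT => qq.
    have qIJ : (q, I) <> (q', J) by move=> [qq' _]; apply: qq; rewrite qq'.
    case: (configuration_separated CI CJ qIJ) => H.
    + have := C12 CI; rewrite Il zz -Jl; move/lt_le_trans => /(_ _ H); by rewrite ltxx.
    + have := C12 CJ; rewrite Jl -zz -Il; move/lt_le_trans => /(_ _ H); by rewrite ltxx.
(* Vanishing extents are left out: 0 may come from several regions or fail to be an endpoint. They
   cost nothing because [f 0 = 0]. *)
pose s := [seq z p | p <- index_enum ('I_n * bool)%type & z p != 0].
have -> : \sum_q (f (x q true) + f (x q false)) = \sum_(y <- s) f y.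
  rewrite big_map big_filter [RHS]big_mkcond /=.
  rewrite [RHS](eq_bigr (fun p => f (x p.1 p.2))); last first.
    by move=> p _; rewrite fz z0; case: eqVneq => [->|]; rewrite ?f_0.
  rewrite -(pair_bigA _ (fun i j => f (x i j))) /=.
  by apply: eq_bigr => q _; rewrite big_bool.
rewrite -big_cat /=; apply: esum_ge_seq.
  rewrite cat_uniq ut andbT; apply/andP; split.
    rewrite map_inj_in_uniq ?filter_uniq ?index_enum_uniq // => p p'.
    by rewrite mem_filter => /andP[zp _] _; exact: z_inj.
  apply/hasPn => y yt; apply/mapP => -[[q b]]; rewrite mem_filter /= => /andP[_ _] yz.
  have [_ /(_ q)[yr yl]] := t_new y yt.
  by move: yz; rewrite /z; case: b.
move=> y /=; rewrite mem_cat => /orP[/mapP[p]|]; last exact: tC.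
by rewrite mem_filter => /andP[zp _] ->; exact: zC.
Qed.

End Configuration.

(** * The explicit standard configuration *)

Section Standard.
Variable m : nat -> R.
Hypothesis m_gt0 : forall k, 0 < m k.
Hypothesis m_le : {homo m : i j / (i <= j)%N >-> i <= j}.
Variable e : nat -> R.
Hypothesis Ge : forall k, G (e k) = altsum m k.

Let e_ge0 k : 0 <= e k.
Proof. by rewrite -G_mono G0 Ge altsum_ge0. Qed.

Let e_small k : (k < 2)%N -> e k = 0.
Proof. by move=> k2; apply: G_inj; rewrite Ge G0; case: k k2 => [|[]]. Qed.

Let e_lt k : e k < e k.+2.
Proof. by rewrite -G_lt !Ge /= ltrDl. Qed.

Let e_gt0 k : 0 < e k.+2.
Proof. exact: le_lt_trans (e_lt k). Qed.

Let e_le i j : (i <= j)%N -> odd i = odd j -> e i <= e j.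
Proof. by move=> ij oij; rewrite -G_mono !Ge altsum_le_same_parity. Qed.

(* Orientation b = true puts the region of least mass to the right of the origin. *)
Definition standard_itv (b : bool) (k : nat) : R * R :=
  if odd k (+) b then (e k, e k.+2) else (- e k.+2, - e k).

Variable n : nat.
Hypothesis n_gt0 : (0 < n)%N.
Local Notation M := (fun i : 'I_n => m i).

(** * Lower bound for the perimeter and its equality case *)

Section LowerBound.
Variable C : 'I_n -> set (R * R).
Hypothesis cC : is_configuration C.
Hypothesis mC : has_masses f M C.

Let pack_extents (x : 'I_n -> bool -> R) (x_ge0 : forall q b, 0 <= x q b) :
  (forall q I, C q I -> - x q false <= I.1 /\ I.2 <= x q true) ->
  forall (W : {set 'I_n}) i j, i \in W -> j \in W ->
  (forall q, q \in W -> x q true <= x i true) ->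
  (forall q, q \in W -> x q false <= x j false) ->
  \sum_(q in W) m q <= G (x i true) + G (x j false).
Proof.
move=> xC W i j Wi Wj imax jmax.
have := @packing n C cC M mC W (- x j false) (x i true).
rewrite G_odd opprK; apply.
  by apply: le_trans (x_ge0 i true); rewrite oppr_le0.
move=> q I Wq CI; have [xl xr] := xC q I CI; split.
  by apply: le_trans xl; rewrite lerN2 jmax.
exact: le_trans xr (imax q Wq).
Qed.

Lemma perimeter_ge : ((\sum_(k < n) f (e k.+2))%:E <= perimeter f C)%E.
Proof.
case: (ltP (perimeter f C) +oo%E) => [fin|]; last by apply: le_trans; rewrite leey.
have [x [x_ge0 xC _ _ xP]] := exists_extents cC fin.
apply: (@le_trans _ _ (\sum_q (f (x q true) + f (x q false)))%:E).
  rewrite lee_fin.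
  exact: (comparison_le f_0 G0 G_mono h_ge0 h_le tangent m_gt0 m_le Ge
    x_ge0 (pack_extents x_ge0 xC) n_gt0).
have := xP [::]; rewrite big_nil addr0; exact.
Qed.

(** Equality leaves no nonzero endpoints besides the outermost ones. The interval of region [t i]
    reaching out to distance [e i.+2] therefore starts at 0 or at the outermost endpoint of a region
    nearer the origin on the same side, hence no further out than [e i]. Its mass is then already at
    least [m i], so it is the whole region. *)
Lemma perimeter_le_standard :
  (perimeter f C <= (\sum_(k < n) f (e k.+2))%:E)%E ->
  exists (b : bool) (s : 'S_n), (forall i, m (s i) = m i) /\
    forall i, C (s i) = [set standard_itv b i].
Proof.
move=> le_per; have fin : (perimeter f C < +oo)%E by apply: le_lt_trans le_per _; rewrite ltey.
have [x [x_ge0 xC xr xl xP]] := exists_extents cC fin.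
have x_eq : \sum_(k < n) f (e k.+2) = \sum_q (f (x q true) + f (x q false)).
  apply/eqP; rewrite eq_le; apply/andP; split.
    exact: (comparison_le f_0 G0 G_mono h_ge0 h_le tangent m_gt0 m_le Ge
    x_ge0 (pack_extents x_ge0 xC) n_gt0).
  rewrite -lee_fin; apply: le_trans le_per.
  by have := xP [::]; rewrite big_nil addr0; exact.
have le_x : \sum_q (f (x q true) + f (x q false)) <= \sum_(k < n) f (e k.+2).
  by rewrite x_eq.
have [b [t [t_inj tP]]] := comparison_eq f_0 G0 G_mono h_ge0 h_le tangent m_gt0 m_le Ge
  x_ge0 (pack_extents x_ge0 xC) n_gt0 le_x.
have s_inj : injective (fun i : 'I_n => t i).
  by move=> i j /t_inj ij; apply: val_inj; apply: ij; rewrite inE /=.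
(* Any other nonzero endpoint would add [f y > 0] to extents whose cost already equals the bound. *)
have endpoint_x y : endpoints C y -> y != 0 -> exists q, y = x q true \/ y = - x q false.
  move=> Cy y0; apply: contrapT => no.
  have : ((\sum_q (f (x q true) + f (x q false)) + f y)%:E <= perimeter f C)%E.
    have := xP [:: y] isT; rewrite big_seq1; apply.
    - by move=> z /=; rewrite inE => /eqP ->.
    - move=> z; rewrite inE => /eqP ->; split => // q.
      by split => yq; apply: no; exists q; [left|right].
  move/le_trans => /(_ _ le_per); rewrite -x_eq lee_fin gerDl; apply/negP.
  by rewrite -ltNge f_pos.
exists b, (perm s_inj); split => [i|i]; rewrite permE.
  by have [] := tP i (ltn_ord i).
have surj q : exists j : 'I_n, q = t j.
  by exists ((perm s_inj)^-1%g q); rewrite -[RHS](permE s_inj) permKV.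
(* Indices on one side share a parity, so an extent below [e i.+2] belongs to an index at least two
   lower. *)
have step j : (j < n)%N -> odd j = odd i -> e j.+2 < e i.+2 -> e j.+2 <= e i.
  move=> jn oji eji; apply: e_le; last by rewrite /= negbK.
  rewrite ltnNge; apply/negP => ij.
  have ij' : (i.+2 <= j.+2)%N.
    have : i != j.+1 :> nat by apply/eqP => E; move: oji; rewrite E /=; case: (odd j).
    by move: ij; lia.
  by move: eji; apply/negP; rewrite -leNgt; apply: e_le => //=; rewrite oji.
have [mi xi xi0] := tP i (ltn_ord i).
have mass_i : mass f (C (t i)) = (m i)%:E by rewrite mC mi.
have reg := cC.1 (t i).
have Gm : G (e i.+2) - G (e i) = m i by rewrite !Ge /= addrAC subrr add0r.
rewrite /standard_itv; case: (boolP (odd i (+) b)) => oib.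
- rewrite oib in xi xi0.
  have [E|[I CI Ir]] := xr (t i); first by have := e_gt0 i; rewrite -xi E ltxx.
  have I0 : 0 <= I.1 by have [+ _] := xC _ _ CI; rewrite xi0 oppr0.
  have I12 := (cC.1 _).1 _ CI.
  have I1 : I.1 <= e i.
    move: I0; rewrite le_eqVlt => /predU1P[<-//|I0].
    have CI1 : endpoints C I.1 by exists (t i), I => //; left.
    have I10 : I.1 != 0 by rewrite gt_eqF.
    have [q Iq] := endpoint_x _ CI1 I10; case: (surj q) => k qk; subst q.
    have [_ xk xk0] := tP k (ltn_ord k).
    have {}Iq : I.1 = x (t k) true.
      case: Iq => // Iq; have := x_ge0 (t k) false; rewrite -oppr_le0 -Iq; lra.
    case: (boolP (odd k (+) b)) => okb.
      rewrite Iq; rewrite okb in xk; rewrite xk; apply: step (ltn_ord k) _ _.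
        by apply: (@addIb b); rewrite okb oib.
      by rewrite -xk -Iq -xi -Ir.
    by rewrite (negbTE okb) in xk0; rewrite Iq xk0 ltxx in I0.
  case: I CI Ir I0 I12 I1 => u v /= CI Ir I0 I12 I1; rewrite Ir xi in CI.
  have [|-> E] := region_eq_set1 reg mass_i CI; last first.
    by congr [set (_, _)]; apply: G_inj; move: E; rewrite -Gm; lra.
  by rewrite -Gm lerD2l lerN2 G_mono.
- rewrite (negbTE oib) in xi xi0.
  have [E|[I CI Il]] := xl (t i); first by have := e_gt0 i; rewrite -xi E ltxx.
  have I0 : I.2 <= 0 by have [_ +] := xC _ _ CI; rewrite xi0.
  have I12 := (cC.1 _).1 _ CI.
  have I2 : - e i <= I.2.
    move: I0; rewrite le_eqVlt => /predU1P[->|I0]; first by rewrite oppr_le0.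
    have CI2 : endpoints C I.2 by exists (t i), I => //; right.
    have I20 : I.2 != 0 by rewrite lt_eqF.
    have [q Iq] := endpoint_x _ CI2 I20; case: (surj q) => k qk; subst q.
    have [_ xk xk0] := tP k (ltn_ord k).
    have {}Iq : I.2 = - x (t k) false.
      case: Iq => // Iq; have := x_ge0 (t k) true; rewrite -Iq; lra.
    case: (boolP (odd k (+) b)) => okb.
      by rewrite okb in xk0; rewrite Iq xk0 oppr0 ltxx in I0.
    rewrite (negbTE okb) in xk; rewrite Iq xk lerN2; apply: step (ltn_ord k) _ _.
      by apply: (@addIb b); rewrite (negbTE okb) (negbTE oib).
    by rewrite -xk -xi -ltrN2 -Iq -Il.
  case: I CI Il I0 I12 I2 => u v /= CI Il I0 I12 I2; rewrite Il xi in CI.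
  have [|-> E] := region_eq_set1 reg mass_i CI; last first.
    congr [set (_, _)]; apply: G_inj; rewrite G_odd; move: E; rewrite -Gm G_odd; lra.
  rewrite -Gm G_odd opprK addrC lerD2r -[leLHS]opprK; move: I2.
  by rewrite -G_mono G_odd; lra.
Qed.

End LowerBound.

(** * Explicit intervals and the definition of a standard configuration *)

Lemma standard_itv_lt b k : (standard_itv b k).1 < (standard_itv b k).2.
Proof. by rewrite /standard_itv; case: (_ (+) _); rewrite /= ?ltrN2 e_lt. Qed.

Lemma reflect_standard_itv b k :
  reflect_region [set standard_itv b k] = [set standard_itv (~~ b) k].
Proof.
rewrite /reflect_region image_set1 /standard_itv addbN.
by case: (_ (+) _); rewrite /= ?opprK.
Qed.

Lemma mem_standard_itv b k y : itv_set (standard_itv b k) y <->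
  e k <= (if odd k (+) b then y else - y) <= e k.+2.
Proof.
rewrite /standard_itv /itv_set; case: (_ (+) _) => //=.
by rewrite lerNl lerNr andbC.
Qed.

Lemma mem_standard_itv_side b k y : itv_set (standard_itv b k) y ->
  0 <= (if odd k (+) b then y else - y).
Proof. by move=> /mem_standard_itv /andP[+ _]; exact: le_trans. Qed.

(** The inner end of interval [i] is the outer end of interval [i - 2], or 0 when [i < 2], so the
    outer ends and 0 exhaust the endpoints. *)
Lemma standard_perimeter_le b (C : 'I_n -> set (R * R)) :
  (forall i, C i = [set standard_itv b i]) ->
  (perimeter f C <= (\sum_(k < n) f (e k.+2))%:E)%E.
Proof.
move=> CE; pose z (k : 'I_n) := if odd k (+) b then e k.+2 else - e k.+2.
have -> : \sum_(k < n) f (e k.+2) = \sum_(y <- 0 :: [seq z k | k <- index_enum 'I_n]) f y.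
  rewrite big_cons f_0 add0r big_map; apply: eq_bigr => k _.
  by rewrite /z; case: (_ (+) _); rewrite // -f_even.
apply: esum_le_seq => s us sC; apply: sum_uniq_le => // y /sC[i [I]].
rewrite CE /= => -> yI; rewrite inE.
have z_mem k : z k \in [seq z k | k <- index_enum 'I_n].
  by apply: map_f; rewrite mem_index_enum.
have [yE|yE] : y = z i \/ y = (if odd i (+) b then e i else - e i).
  by move: yI; rewrite /standard_itv /z; case: (_ (+) _) => -[->|->]; [right|left|left|right].
  by rewrite yE z_mem orbT.
have [i2|i2] := ltnP i 2; first by rewrite yE e_small // oppr0 if_same eqxx.
have i2n : (i - 2 < n)%N by rewrite (leq_ltn_trans (leq_subr _ _)).
apply/orP; right; rewrite yE.
have -> : (if odd i (+) b then e i else - e i) = z (Ordinal i2n).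
  rewrite /z /= oddB // addbF; have -> : (i - 2).+2 = i by lia.
  by [].
exact: z_mem.
Qed.

Lemma standard_itv_separated b i j : i != j ->
  (standard_itv b i).2 <= (standard_itv b j).1 \/
  (standard_itv b j).2 <= (standard_itv b i).1.
Proof.
wlog ij : i j / (i < j)%N.
  by move=> H nij; case: (ltngtP i j) nij => // ij _; [|rewrite or_comm]; apply: H; lia.
move=> _; rewrite /standard_itv.
have [oij|oij] := eqVneq (odd i) (odd j).
  have : e i.+2 <= e j.
    apply: e_le; last by rewrite /= negbK.
    have : j != i.+1 by apply: contraPneq oij => ->; rewrite /=; case: (odd i).
    by move: ij; lia.
  by rewrite oij; case: (_ (+) _) => /= eij; [left|right; rewrite lerN2].
have -> : odd i (+) b = ~~ (odd j (+) b).
  by rewrite -addNb; congr (_ (+) _); move: oij; case: (odd i); case: (odd j).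
by case: (_ (+) _) => /=; [left|right]; rewrite (@le_trans _ _ 0) ?oppr_le0.
Qed.

Lemma is_configuration_standard b :
  is_configuration (fun i : 'I_n => [set standard_itv b i]).
Proof.
split=> [i|i j I J ij -> ->].
  by split=> [I ->|I J -> -> //]; exact: standard_itv_lt.
by apply: itv_touching; rewrite ?standard_itv_lt //; exact: standard_itv_separated.
Qed.

Lemma has_masses_standard b : has_masses f M (fun i => [set standard_itv b i]).
Proof.
move=> i; rewrite mass_set1 ?standard_itv_lt // /itv_mass /standard_itv.
by case: (_ (+) _); rewrite /= ?G_odd !Ge /=; congr (_%:E); lra.
Qed.

(** Descend two indices at a time, that is, towards the origin on the same side, until the interval
    contains [y]. *)
Lemma standard_cover b k y : (k < n)%N ->
  0 <= (if odd k (+) b then y else - y) <= e k.+2 ->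
  exists i : 'I_n, itv_set (standard_itv b i) y.
Proof.
elim/ltn_ind: k y => k IH y kn /andP[y0 yk].
case: (leP (e k) (if odd k (+) b then y else - y)) => ky.
  by exists (Ordinal kn); apply/mem_standard_itv; rewrite ky.
have [k2|k2] := ltnP k 2; first by move: ky; rewrite e_small // ltNge y0.
apply: (IH (k - 2)%N); [lia|lia|].
by rewrite oddB // addbF y0 /=; have -> : (k - 2).+2 = k; [lia|exact: ltW].
Qed.

(** A point between two covered points lies, on its own side, between the origin and one of them,
    where [standard_cover] applies. *)
Lemma standard_union_is_interval b :
  is_interval (\bigcup_(i in [set: 'I_n]) itv_set (standard_itv b i)).
Proof.
have cov k y : (k < n)%N -> 0 <= (if odd k (+) b then y else - y) <= e k.+2 ->
    (\bigcup_(i in [set: 'I_n]) itv_set (standard_itv b i)) y.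
  by move=> kn /(standard_cover kn)[i]; exists i.
have cov0 : (\bigcup_(i in [set: 'I_n]) itv_set (standard_itv b i)) 0.
  by apply: (cov 0 _ n_gt0); rewrite oppr0 if_same lexx e_ge0.
move=> x z [i _ xi] [j _ zj] y /andP[xy yz].
case: (ltgtP y 0) => y0; last by rewrite y0.
- move/mem_standard_itv : xi => /andP[xi xi'].
  apply: (cov i) => //; case: (boolP (odd i (+) b)) xi xi' => oib xi xi'.
    by have := le_trans (e_ge0 i) xi; lra.
  by apply/andP; split; lra.
- move/mem_standard_itv : zj => /andP[zj zj'].
  apply: (cov j) => //; case: (boolP (odd j (+) b)) zj zj' => ojb zj zj'.
    by apply/andP; split; lra.
  by have := le_trans (e_ge0 j) zj; lra.
Qed.

Lemma standard_itv_right b k :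
  itv_set (standard_itv b k) `<=` @right_side R <-> odd k (+) b.
Proof.
split=> [H|okb x /mem_standard_itv_side]; last by rewrite okb.
apply/negPn/negP => okb; have : itv_set (standard_itv b k) (- e k.+2).
  by apply/mem_standard_itv; rewrite (negbTE okb) /= opprK lexx ltW.
by move/H; rewrite /right_side /= leNgt oppr_lt0 e_gt0.
Qed.

Lemma standard_itv_left b k :
  itv_set (standard_itv b k) `<=` @left_side R <-> ~~ (odd k (+) b).
Proof.
split=> [H|/negbTE okb x /mem_standard_itv_side]; last by rewrite okb oppr_ge0.
apply/negP => okb; have : itv_set (standard_itv b k) (e k.+2).
  by apply/mem_standard_itv; rewrite okb /= lexx ltW.
by move/H; rewrite /left_side /= leNgt e_gt0.
Qed.

Lemma is_standard_standard : is_standard f M (fun i => [set standard_itv true i]).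
Proof.
split; [exact: is_configuration_standard|exact: has_masses_standard|].
have order i j : odd i = odd j -> e i.+2 <= e j -> (i < j)%N /\ m i <= m j.
  move=> oij eij; suff ij : (i < j)%N by split => //; apply: m_le; exact: ltnW.
  rewrite ltnNge; apply/negP => ji; have := e_le ji (esym oij).
  by have := e_lt i; lra.
exists (fun i => standard_itv true i); split=> //.
split; last split; last split; last split; last split.
- move=> i; case: (boolP (odd i (+) true)) => oi; [left|right].
    exact/standard_itv_right.
  exact/standard_itv_left.
- exact: standard_union_is_interval.
- exists (Ordinal n_gt0); apply/mem_standard_itv.
  by rewrite /= (@e_small 0) // lexx e_ge0.
- move=> i j /standard_itv_right oi /standard_itv_right oj.
  rewrite /standard_itv oi oj /=; apply: order.
  by apply: (@addIb true); rewrite oi oj.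
- move=> i j /standard_itv_left /negbTE oi /standard_itv_left /negbTE oj.
  rewrite /standard_itv oi oj /= lerN2; apply: order.
  by apply: (@addIb true); rewrite oi oj.
- left => i /=; case: (boolP (odd i)) => oi /=.
    by apply/standard_itv_left; rewrite oi.
  by apply/standard_itv_right; rewrite (negbTE oi).
Qed.

(** Intervals with indices of equal parity follow each other outwards and the covering hypothesis
    leaves no gap, so each begins where the one two indices lower ends, or at 0; its mass then fixes
    the outer end. *)
Lemma chained_itvE (J : 'I_n -> R * R) :
  (forall i, 0 <= (J i).1 < (J i).2) ->
  (forall i, G (J i).2 - G (J i).1 = m i) ->
  (forall i j : 'I_n, odd i = odd j -> (i < j)%N -> (J i).2 <= (J j).1) ->
  (forall i y, 0 < y < (J i).1 ->
     exists j : 'I_n, odd j = odd i /\ (J j).1 <= y <= (J j).2) ->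
  forall i : 'I_n, J i = (e i, e i.+2).
Proof.
move=> J12 JG Jord Jcov [k kn]; elim/ltn_ind: k kn => k IH kn.
set i := Ordinal kn.
have /andP[J0 Jlt] := J12 i.
have ge_e : e k <= (J i).1.
  have [k2|k2] := ltnP k 2; first by rewrite e_small.
  have k2n : (k - 2 < n)%N by lia.
  have := Jord (Ordinal k2n) i; rewrite IH /=; last lia.
  rewrite oddB // addbF => /(_ erefl); have -> : (k - 2).+2 = k by lia.
  by apply; lia.
have J1 : (J i).1 = e k.
  apply/eqP; rewrite eq_le ge_e andbT leNgt; apply/negP => lt_e.
  (* The midpoint of the supposed gap would lie in some [J j] of the same parity, but [J j] ends too
     early if [j < k] and starts too late otherwise. *)
  have [|j [oij /andP[jy yj]]] := Jcov i ((e k + (J i).1) / 2).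
    by have := e_ge0 k; move: lt_e => lt_e ek; apply/andP; split; lra.
  case: (ltngtP j k) => jk.
  - have Jj : J j = (e j, e j.+2).
      by have := IH j jk (ltn_ord j); rewrite (_ : Ordinal _ = j) //; exact: val_inj.
    have : e j.+2 <= e k.
      apply: e_le; last by rewrite /= negbK oij.
      have : k != j.+1 :> nat.
        by apply/eqP => E; move: oij; rewrite /= E /=; case: (odd j).
      by move: jk; lia.
    by move: yj; rewrite Jj /=; lra.
  - have := Jord i j (esym oij) jk; lra.
  - have ij : j = i by apply: val_inj.
    by move: jy; rewrite ij; lra.
rewrite [J i]surjective_pairing J1; congr (_, _); apply: G_inj.
by have := JG i; rewrite J1 !Ge /=; lra.
Qed.

Lemma is_standardP (C : 'I_n -> set (R * R)) : is_standard f M C ->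
  exists b, forall i, C i = [set standard_itv b i].
Proof.
move=> [cC mC [I [CI [_ [UI [[i0 U0] [ordr [ordl sides]]]]]]]].
(* Numbering from 0 makes an odd usual index an even [i]; [b] records whether those regions lie on
   the right. *)
have [b side] : exists b, forall i : 'I_n,
    itv_set (I i) `<=` if odd i (+) b then @right_side R else @left_side R.
  case: sides => sides; [exists true|exists false] => i; have := sides i => /=.
    by rewrite addbT.
  by rewrite addbF; case: (odd i).
exists b.
have CII i : C i (I i) by rewrite CI.
have I12 i : (I i).1 < (I i).2 by exact: (cC.1 i).1.
have sep (i j : 'I_n) : i != j -> (I i).2 <= (I j).1 \/ (I j).2 <= (I i).1.
  move=> ij; apply: (configuration_separated cC (CII i) (CII j)).
  by case=> /eqP; rewrite (negbTE ij).
have I1 i : itv_set (I i) (I i).1 by rewrite /itv_set /= lexx ltW.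
have I2 i : itv_set (I i) (I i).2 by rewrite /itv_set /= lexx andbT ltW.
have mI i : G (I i).2 - G (I i).1 = m i.
  by apply: EFin_inj; rewrite -mC CI mass_set1.
(* Left intervals are reflected to the right, so that [chained_itvE] treats both sides at once. *)
pose J (i : 'I_n) := if odd i (+) b then I i else (- (I i).2, - (I i).1).
have cov x y z : (exists i, itv_set (I i) x) -> (exists i, itv_set (I i) z) ->
    x <= y <= z -> exists i, itv_set (I i) y.
  move=> [i xi] [j zj] xyz; suff [k _ yk] : (\bigcup_i itv_set (I i)) y by exists k.
  by apply: (UI x z _ _ y xyz); [exists i|exists j].
suff JE (i : 'I_n) : J i = (e i, e i.+2).
  move=> i; rewrite CI; congr [set _]; move: (JE i).
  rewrite /J /standard_itv; case: (_ (+) _) => // -[<- <-]; rewrite !opprK.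
  exact: surjective_pairing.
move: i; apply: chained_itvE => i.
- rewrite /J; have := side i; case: (_ (+) _) => S /=.
    by rewrite I12 andbT; apply: S (I1 i).
  by rewrite ltrN2 I12 andbT oppr_ge0; apply: S (I2 i).
- by rewrite /J; case: (_ (+) _) => /=; rewrite ?G_odd -mI; lra.
- move=> j oij ij; have nij : i != j by apply/eqP => E; rewrite E ltnn in ij.
  rewrite /J -oij; have := side i; have := side j; rewrite -oij.
  case: (_ (+) _) => Sj Si /=.
    case: (sep i j nij) => // ji; have [] := ordr j i Sj Si ji; lia.
  rewrite lerN2; case: (sep i j nij) => // ji.
  by have [] := ordl j i Sj Si ji; lia.
(* A point between 0 and an interval is covered because the union is an interval containing 0, and
   its sign determines the parity of the index covering it. *)
- move=> y; rewrite /J; have := side i; case oi : (_ (+) _) => S /= /andP[y0 yi].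
    have [j jy] : exists j, itv_set (I j) y.
      by apply: (cov 0 y (I i).1); [exists i0|exists i|rewrite !ltW].
    exists j; have := side j; case oj : (_ (+) _) => Sj.
      by split; first by apply: (@addIb b); rewrite oi oj.
    by have := Sj _ jy; rewrite /left_side /= leNgt y0.
  have [j jy] : exists j, itv_set (I j) (- y).
    by apply: (cov (I i).2 (- y) 0); [exists i|exists i0|rewrite oppr_le0 lerNr !ltW].
  exists j; have := side j; case oj : (_ (+) _) => Sj.
    by have := Sj _ jy; rewrite /right_side /= leNgt oppr_lt0 y0.
  split; first by apply: (@addIb b); rewrite oi oj.
  by move: jy; rewrite /itv_set /= lerNl lerNr andbC.
Qed.

End Standard.
End Bubbles.

Unset Implicit Arguments.

Theorem theorem1 (R : realType) (f : R -> R)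
  (f_ge0 : forall x : R, 0 <= f x)
  (f_even : forall x : R, f x = f (- x))
  (f_0 : f 0 = 0)
  (f_deriv : forall x : R, 0 < x -> derivable f x 1 /\ 0 <= derive1 f x)
  (f_pos : forall x : R, x != 0 -> 0 < f x)
  (lnf_deriv2 : forall x : R, x != 0 ->
     [/\ derivable (fun y => ln (f y)) x 1,
         derivable (derive1 (fun y => ln (f y))) x 1
       & derive1n 2 (fun y => ln (f y)) x < 0])
  (n : nat) (n_gt0 : (0 < n)%N) (M : 'I_n -> R)
  (M_gt0 : forall i : 'I_n, 0 < M i)
  (M_le : forall i j : 'I_n, (i <= j)%N -> M i <= M j) :
  (exists C : 'I_n -> set (R * R), is_standard f M C) /\
  (forall C : 'I_n -> set (R * R), is_standard f M C ->
     is_isoperimetric f M C /\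
     (forall D : 'I_n -> set (R * R), is_isoperimetric f M D ->
        exists2 s : 'S_n, (forall i : 'I_n, M (s i) = M i) &
          (forall i : 'I_n, D (s i) = C i) \/
          (forall i : 'I_n, D (s i) = reflect_region (C i)))).
Proof.
have [m [m_gt0 m_le ME]] : exists m : nat -> R,
    [/\ forall k, 0 < m k, {homo m : i j / (i <= j)%N >-> i <= j} &
        M = fun i => m i].
  case: n n_gt0 M M_gt0 M_le => // k _ M0 M0_gt0 M0_le.
  (* The last mass is repeated beyond index [k], which keeps the infinite sequence positive and
     nondecreasing. *)
  exists (fun i => M0 (inord (minn i k))); split=> // [i j ij|].
    by apply: M0_le; rewrite !inordK ?ltnS ?geq_minr // leq_min geq_minr geq_min ij.
  apply/funext => i; congr M0; apply: val_inj.
  by rewrite /= inordK ?ltnS ?geq_minr // (minn_idPl _) // -ltnS.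
subst M.
have [G [h [[G_mono G_odd G_surj G_int] [h_ge0 h_le tangent]]]] :=
  volume_coordinate f_ge0 f_even f_0 f_deriv f_pos lnf_deriv2.
have [e Ge] := choice (fun k => G_surj (altsum m k)).
have f_le := density_le f_deriv.
split.
  exists (fun i => [set standard_itv e true i]).
  exact: is_standard_standard Ge _ n_gt0.
move=> C stC; have [b CE] := is_standardP G_mono G_odd G_int m_gt0 Ge n_gt0 stC.
have perC := standard_perimeter_le f_ge0 f_even f_0 G_mono G_odd Ge n_gt0 CE.
split.
  have [cC mC _] := stC; split => // D cD mD; apply: le_trans perC _.
  exact: (perimeter_ge (h := h)).
move=> D [cD mD minD]; have [cC mC _] := stC.
have [b' [s [ms DE]]] := perimeter_le_standard (h := h) f_ge0 f_even f_0 f_pos f_le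
  G_mono G_odd G_int h_ge0 h_le tangent m_gt0 m_le Ge n_gt0 cD mD
  (le_trans (minD C cC mC) perC).
(* The orientations of the minimizer and of [C] either agree or are mirror images of each other. *)
exists s => //; case: (eqVneq b' b) => [bb|bb]; [left|right] => i.
  by rewrite DE bb CE.
rewrite DE CE reflect_standard_itv; congr [set standard_itv e _ i].
by move: bb; case: b' {DE}; case: (b).
Qed.
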